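(* Let $d\ge 2$ and let $\mathcal{E}\subset\mathbb{R}^d$ be an ellipsoid with semiaxes $a_1,\dots,a_d>0$. For every $k\in\{1,\ldots,d\}$, $$V_k(\mathcal{E})=\kappa_k\sum_{i=1}^d a_i^2\, s_{k-1}(a_1^2,\dots,a_{i-1}^2,a_{i+1}^2,\dots,a_d^2)\int_0^{\infty}\frac{t^{k-1}}{(a_i^2t^2+1)\prod_{j=1}^d\sqrt{a_j^2t^2+1}}\,dt,$$ where $V_k$ denotes the $k$-th intrinsic volume, $s_{k-1}$ is the $(k-1)$-th elementary symmetric polynomial and $\kappa_k$ is the volume of the $k$-dimensional unit ball.
   Context: An ellipsoid with semiaxes $a_1,\dots,a_d>0$ is a set which, up to a rigid motion of $\mathbb{R}^d$, equals $\{(x_1,\dots,x_d)\in\mathbb{R}^d:\sum_{i=1}^d x_i^2/a_i^2\le 1\}$. $\kappa_k:=\pi^{k/2}/\Gamma(\frac k2+1)$ is the volume of the $k$-dimensional unit ball ($\kappa_0=1$). For a non-empty compact convex set $K\subset\mathbb{R}^d$, the intrinsic volumes $V_0(K),\dots,V_d(K)$ are the coefficients uniquely defined by the Steiner formula $$|K+r\mathbb{B}^d|_d=\sum_{k=0}^d\kappa_{d-k}V_k(K)\,r^{d-k},\qquad r\ge 0,$$ where $|\cdot|_d$ is Lebesgue measure on $\mathbb{R}^d$, $\mathbb{B}^d$ is the $d$-dimensional unit ball and $+$ is Minkowski (pointwise) addition. For $m\le n$, $s_m(t_1,\dots,t_n):=\sum_{1\le i_1<\dots<i_m\le n}\prod_{j=1}^m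 t_{i_j}$ is the $m$-th elementary symmetric polynomial, with $s_0=1$. *)

(* Defs.v *)
From HB Require Import structures.
From mathcomp Require Import all_boot all_order all_algebra.
From mathcomp Require Import all_classical all_reals all_analysis.

Set Implicit Arguments.
Unset Strict Implicit.
Unset Printing Implicit Defensive.

Import Order.TTheory GRing.Theory Num.Theory.
Import numFieldNormedType.Exports.

Local Open Scope classical_set_scope.
Local Open Scope ring_scope.

Section lebesgue_tuple.
Context {R : realType}.
Local Notation mR := (measurableTypeR R).

Definition pair_cons n (p : mR * n.-tuple mR) : n.+1.-tuple mR :=
  [the n.+1.-tuple mR of p.1 :: p.2].

Lemma measurable_pair_cons n :
  measurable_fun [set: mR * n.-tuple mR] (@pair_cons n).
Proof. exact: measurable_cons. Qed.

Lemma measurable_pair_uncons n : measurable_fun [set: n.+1.-tuple mR]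
  (fun t : n.+1.-tuple mR => (thead t, [tuple of behead t])).
Proof.
apply/measurable_fun_pairP; split; first exact: (measurable_tnth ord0).
exact: measurable_behead.
Qed.

Section tuple_prod.
Variables (n : nat) (mu : {sigma_finite_measure set (n.-tuple mR) -> \bar R}).

Definition tuple_prod : set (n.+1.-tuple mR) -> \bar R :=
  pushforward (lebesgue_measure \x mu)%E (@pair_cons n).

Let tuple_prod0 : tuple_prod set0 = 0%E.
Proof. by rewrite /tuple_prod /pushforward preimage_set0 measure0. Qed.

Let tuple_prod_ge0 A : (0 <= tuple_prod A)%E.
Proof. by rewrite /tuple_prod /pushforward; exact: measure_ge0. Qed.

Let tuple_prod_sigma_additive : semi_sigma_additive tuple_prod.
Proof.
move=> F mF tF mUF; rewrite /tuple_prod /pushforward preimage_bigcup.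
apply: measure_semi_sigma_additive.
- by move=> i; rewrite -[X in measurable X]setTI; exact: measurable_pair_cons.
- apply/trivIsetP => /= i j _ _ ij; rewrite -preimage_setI.
  by move/trivIsetP : tF => /(_ _ _ _ _ ij) ->//; rewrite preimage_set0.
- rewrite -preimage_bigcup -[X in measurable X]setTI.
  exact: measurable_pair_cons.
Qed.

HB.instance Definition _ := isMeasure.Build _ _ _ tuple_prod
  tuple_prod0 tuple_prod_ge0 tuple_prod_sigma_additive.

Let tuple_prod_sigma_finite : sigma_finite [set: n.+1.-tuple mR] tuple_prod.
Proof.
have /sigma_finiteP[F [TF ndF Foo]] := sigma_finiteT (@lebesgue_measure R).
have /sigma_finiteP[G [TG ndG Goo]] := sigma_finiteT mu.
exists (fun i => (fun t : n.+1.-tuple mR =>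
    (thead t, [tuple of behead t])) @^-1` (F i `*` G i)).
  rewrite -preimage_bigcup (_ : \bigcup_i _ = setT) ?preimage_setT//.
  apply/seteqP; split=> // -[x y] _.
  have [i _ Fx] : (\bigcup_i F i) x by rewrite -TF.
  have [j _ Gy] : (\bigcup_i G i) y by rewrite -TG.
  exists (maxn i j) => //; split=> /=.
  - by move: x Fx; exact/subsetPset/ndF/leq_maxl.
  - by move: y Gy; exact/subsetPset/ndG/leq_maxr.
move=> i; have [mF Fioo] := Foo i; have [mG Gioo] := Goo i; split.
  rewrite -[X in measurable X]setTI.
  by apply: measurable_pair_uncons => //; exact: measurableX.
rewrite /tuple_prod /pushforward (_ : _ @^-1` _ = F i `*` G i); last first.
  rewrite -comp_preimage; apply/seteqP; split=> -[x t] /=;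
    by rewrite /pair_cons /= (_ : [tuple of _] = t)//; exact/val_inj.
by rewrite product_measure1E// lte_mul_pinfty// ge0_fin_numE.
Qed.

HB.instance Definition _ :=
  Measure_isSigmaFinite.Build _ _ _ tuple_prod tuple_prod_sigma_finite.

End tuple_prod.

Fixpoint lebesgue_tuple n : {sigma_finite_measure set (n.-tuple mR) -> \bar R} :=
  if n is m.+1 then tuple_prod (lebesgue_tuple m) else \d_[tuple].

Lemma lebesgue_tuple_box n (A : 'I_n -> set mR) :
  (forall i, measurable (A i)) ->
  lebesgue_tuple n [set t : n.-tuple mR | forall i, A i (tnth t i)] =
  (\prod_(i < n) lebesgue_measure (A i))%E.
Proof.
elim: n A => [|n IHn] A mA /=.
  by rewrite big_ord0 diracE mem_set// => -[].
rewrite big_ord_recl -IHn; last by move=> i; exact: mA.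
rewrite /tuple_prod /pushforward.
set B := [set t : n.-tuple mR | _].
rewrite (_ : _ @^-1` _ = A ord0 `*` B); last first.
  apply/seteqP; split=> -[x t] /= H.
    split; first exact: (H ord0).
    by move=> i; have := H (lift ord0 i); rewrite tnthS.
  case: H => Ax Bt i; case: (unliftP ord0 i) => [j ->|-> //].
  by rewrite tnthS; exact: Bt.
rewrite product_measure1E//.
rewrite (_ : B = \bigcap_(i in [set: 'I_n]) ((@tnth n mR)^~ i @^-1` A (lift ord0 i))).
  apply: fin_bigcap_measurable => // i _; rewrite -[X in measurable X]setTI.
  by apply: measurable_tnth => //; exact: mA.
by apply/seteqP; split=> t H i; [move=> _; exact: H|exact: (H i I)].
Qed.

End lebesgue_tuple.

Section intrinsic_volumes.
Context {R : realType}.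

(* The carrier of matrices has no measurable structure of its own; a row
   vector is measured through its tuple of coordinates. *)
Definition volume d (A : set 'rV[R]_d) : \bar R :=
  lebesgue_tuple d [set t | A (\row_i tnth t i)].

Definition Gamma (s : R) : R :=
  \int[lebesgue_measure]_(t in `]0, +oo[) (t `^ (s - 1) * expR (- t)).

Definition kappa (k : nat) : R := pi `^ (k%:R / 2) / Gamma (k%:R / 2 + 1).

(* The library's norm on ['rV_d] is the sup norm, hence the explicit
   Euclidean norm. *)
Definition enorm d (x : 'rV[R]_d) : R := Num.sqrt (\sum_(i < d) x 0 i ^+ 2).

Definition unit_ball d : set 'rV[R]_d := [set x | enorm x <= 1].

Definition minkowski_sum d (A B : set 'rV[R]_d) : set 'rV[R]_d :=
  [set x + y | x in A & y in B].

Definition dilate d (r : R) (A : set 'rV[R]_d) : set 'rV[R]_d :=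
  [set r *: x | x in A].

Definition steiner_formula d (K : set 'rV[R]_d) (V : 'I_d.+1 -> R) : Prop :=
  forall r, 0 <= r ->
    volume (minkowski_sum K (dilate r (@unit_ball d))) =
    (\sum_(k < d.+1) kappa (d - k) * V k * r ^+ (d - k))%:E.

(* Steiner's formula determines the family of coefficients uniquely (and it
   exists for every non-empty compact convex [K]); the default value 0 is used
   only when no such family exists. *)
Definition intrinsic_volume d (K : set 'rV[R]_d) (k : 'I_d.+1) : R :=
  xget (0 : R) [set v | exists2 V, steiner_formula K V & v = V k].

Definition rigid_motion d (f : 'rV[R]_d -> 'rV[R]_d) : Prop :=
  exists (Q : 'M[R]_d) (c : 'rV[R]_d),
    Q *m Q^T = 1%:M /\ forall x, f x = x *m Q + c.

Definition is_ellipsoid d (a : 'I_d -> R) (E : set 'rV[R]_d) : Prop :=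
  exists2 f, rigid_motion f &
    E = f @` [set x : 'rV[R]_d | \sum_(i < d) x 0 i ^+ 2 / a i ^+ 2 <= 1].

Definition elem_sym n (m : nat) (t : 'I_n -> R) : R :=
  \sum_(A : {set 'I_n} | #|A| == m) \prod_(j in A) t j.

End intrinsic_volumes.

(* Main.v *)
Require Import Defs.
From mathcomp Require Import all_boot all_order all_algebra.
From mathcomp Require Import all_classical all_reals all_analysis.
From mathcomp Require Import measurable_realfun ring lra.

(** Let [E] be the ellipsoid with semiaxes [a_i] along the coordinate axes, [B]
    the unit ball and [r > 0]. A point outside [r B] can be written in exactly
    one way as [x_i = (r + l a_i^2) v_i] with [|v| = 1] and [l > 0]. It is then
    [r v + l a^2 v], and [l a^2 v] is the point with outer normal [v] on the
    boundary of a dilate of [E], the ratio of which is [l |a v|]. Hence [E + r B]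
    consists of [r B] and of the points with [l |a v| <= 1]. For fixed [l] these
    points run over an ellipsoid with semiaxes [r + l a_i^2], so that the volume
    element is [dl dv] times
      [prod_i (r + l a_i^2) sum_j a_j^2 v_j^2 / (r + l a_j^2)
         = sum_j sum_m a_j^2 v_j^2 s_m(a_i^2, i <> j) l^m r^(d - 1 - m)].
    Integrating in [l] yields a polynomial in [r], which is Steiner's formula,
    and the coefficient of [r^(d - k)] is a combination of the integrals over the
    sphere of [v_j^2 / |a v|^k].

    The sphere is traded for a Gaussian weight, so that only diagonal linear
    substitutions are used. If [g] is the gauge of [K = E + r B], then
    [int exp (- g^2)] is [Gamma (d / 2 + 1)] times the volume of [K]
    ([volume_gauge]). Put [q_l(x) = sum_i x_i^2 / (r + l a_i^2)^2]. It decreases in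
    [l], and [g(x)^2 = q_l(x)] at the [l] for which [l |a v| = |v|], where
    [v_i = x_i / (r + l a_i^2)] ([mem_parallel_body]). So [exp (- g(x)^2)] is
    [exp (- |x|^2 / r^2)] plus the integral of the derivative of [exp (- q_l(x))]
    from [0] to this [l] ([integral_layer_density]). Tonelli's theorem and, for
    fixed [l], the substitution [x = (r + l a^2) v] give the volume as a
    polynomial in [r] ([integral_gauge_gauss]).

    What remains are the integrals of [v_j^2 (|v| / |a v|)^k exp (- |v|^2)]. By
    homogeneity, removing the factor [|v|^k] costs only a quotient of Gaussian
    moments; then [|a v|^(- k)] is replaced by a multiple of
    [int t^(k - 1) exp (- t^2 |a v|^2) dt], and the Gaussian integral in [v]
    produces the integral over [t] of the theorem ([radial_integral_closed]). The
    Gaussian moments are values of Gamma and combine into [kappa_k] and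
    [kappa_(d - k)] ([volume_parallel_body]).

    The case [r = 0] follows by a limit ([volume_std_ellipsoid]), a rigid motion
    preserves volume ([volume_rigid]), and the coefficients in Steiner's formula
    are unique because a polynomial has finitely many roots
    ([steiner_formula_unique]). *)

Set Implicit Arguments.
Unset Strict Implicit.

Import Order.TTheory GRing.Theory Num.Theory.
Import numFieldNormedType.Exports.

Local Open Scope classical_set_scope.
Local Open Scope ring_scope.


(** * Iverson brackets and measurability *)

(** Domains of integration are encoded by brackets in the integrand, so that
    integrals run over a whole space and Tonelli's theorem applies to them
    directly. *)
Definition iverson {R : realType} (b : bool) : R := b%:R.

Lemma iverson_ge0 {R : realType} b : 0 <= iverson b :> R.
Proof. by rewrite /iverson ler0n. Qed.
#[local] Hint Resolve iverson_ge0 : core.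

Section iverson.
Context {R : realType}.

Lemma iversonT : iverson true = 1 :> R. Proof. by []. Qed.

Lemma iversonF : iverson false = 0 :> R. Proof. by []. Qed.

Lemma iversonM (b c : bool) : iverson (b && c) = iverson b * iverson c :> R.
Proof. by rewrite /iverson -natrM mulnb. Qed.

End iverson.

(** The closure properties of measurable real functions with the bound variable
    displayed, which is the form that the tactic [mfun] below matches. *)
Section measurability.
Context {d : measure_display} {T : measurableType d} {R : realType}.
Implicit Types f g : T -> R.

Lemma mfunD f g : measurable_fun [set: T] f -> measurable_fun [set: T] g ->
  measurable_fun [set: T] (fun x => f x + g x).
Proof. exact: measurable_funD. Qed.

Lemma mfunM f g : measurable_fun [set: T] f -> measurable_fun [set: T] g ->
  measurable_fun [set: T] (fun x => f x * g x).
Proof. exact: measurable_funM. Qed.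

Lemma mfunN f : measurable_fun [set: T] f ->
  measurable_fun [set: T] (fun x => - f x).
Proof. exact: measurable_funN. Qed.

Lemma mfunX f n : measurable_fun [set: T] f ->
  measurable_fun [set: T] (fun x => f x ^+ n).
Proof. exact: measurable_funX. Qed.

Lemma mfun_expR f : measurable_fun [set: T] f ->
  measurable_fun [set: T] (fun x => expR (f x)).
Proof. by move=> mf; apply: measurableT_comp => //. Qed.

Lemma mfunV f : measurable_fun [set: T] f ->
  measurable_fun [set: T] (fun x => (f x)^-1).
Proof.
move=> mf; apply: (measurableT_comp (f := @GRing.inv R)) => //.
rewrite (_ : [set: R] = [set 0] `|` ~` [set 0]); last by rewrite setUv.
apply/measurable_funU => //; first exact: measurableC.
split; first exact: measurable_fun_set1.
apply: open_continuous_measurable_fun; last first.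
  by move=> x /set_mem/= /eqP; exact: inv_continuous.
by apply: closed_openC; exact/accessible_closed_set1/hausdorff_accessible/norm_hausdorff.
Qed.

Lemma mfun_sqrt f : measurable_fun [set: T] f ->
  measurable_fun [set: T] (fun x => Num.sqrt (f x)).
Proof.
move=> mf; apply: (measurableT_comp (f := @Num.sqrt R)) => //.
by apply: continuous_measurable_fun; exact: sqrt_continuous.
Qed.

Lemma mfun_sum (I : Type) (s : seq I) (P : pred I) (F : I -> T -> R) :
  (forall i, measurable_fun [set: T] (F i)) ->
  measurable_fun [set: T] (fun x => \sum_(i <- s | P i) F i x).
Proof.
move=> mF; under eq_fun do rewrite big_mkcond/=.
apply: measurable_sum => i; case: (P i) => //; exact: measurable_cst.
Qed.

Lemma mfun_prod (I : Type) (s : seq I) (P : pred I) (F : I -> T -> R) :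
  (forall i, measurable_fun [set: T] (F i)) ->
  measurable_fun [set: T] (fun x => \prod_(i <- s | P i) F i x).
Proof.
move=> mF; elim: s => [|i s IH].
  by under eq_fun do rewrite big_nil; exact: measurable_cst.
under eq_fun do rewrite big_cons.
by case: (P i) => //; exact: mfunM.
Qed.

Lemma mfun_lt f g : measurable_fun [set: T] f -> measurable_fun [set: T] g ->
  measurable_fun [set: T] (fun x => iverson (f x < g x) : R).
Proof.
move=> mf mg.
apply: (measurableT_comp (f := fun b : bool => b%:R : R)) => //.
exact: measurable_fun_ltr.
Qed.

Lemma mfun_le f g : measurable_fun [set: T] f -> measurable_fun [set: T] g ->
  measurable_fun [set: T] (fun x => iverson (f x <= g x) : R).
Proof.
move=> mf mg.
apply: (measurableT_comp (f := fun b : bool => b%:R : R)) => //.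
exact: measurable_fun_ler.
Qed.

Lemma mfun_and (b c : T -> bool) :
  measurable_fun [set: T] (fun x => iverson (b x) : R) ->
  measurable_fun [set: T] (fun x => iverson (c x) : R) ->
  measurable_fun [set: T] (fun x => iverson (b x && c x) : R).
Proof.
move=> mb mc; rewrite (_ : (fun _ => _) = (fun x => iverson (b x) * iverson (c x))).
  exact: mfunM.
by apply/funext => x; rewrite iversonM.
Qed.

End measurability.

Ltac mfun_step :=
  match goal with
  | |- measurable_fun _ (fun x => @?f x + @?g x) => apply: (@mfunD _ _ _ f g)
  | |- measurable_fun _ (fun x => @?f x * @?g x) => apply: (@mfunM _ _ _ f g)
  | |- measurable_fun _ (fun x => - @?f x) => apply: (@mfunN _ _ _ f)
  | |- measurable_fun _ (fun x => @?f x ^+ ?n) => apply: (@mfunX _ _ _ f n)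
  | |- measurable_fun _ (fun x => (@?f x)^-1) => apply: (@mfunV _ _ _ f)
  | |- measurable_fun _ (fun x => expR (@?f x)) => apply: (@mfun_expR _ _ _ f)
  | |- measurable_fun _ (fun x => Num.sqrt (@?f x)) => apply: (@mfun_sqrt _ _ _ f)
  | |- measurable_fun _ (fun x => iverson (@?f x < @?g x)) => apply: (@mfun_lt _ _ _ f g)
  | |- measurable_fun _ (fun x => iverson (@?f x <= @?g x)) => apply: (@mfun_le _ _ _ f g)
  | |- measurable_fun _ (fun x => iverson (@?f x && @?g x)) => apply: (@mfun_and _ _ _ f g)
  | |- measurable_fun _ (fun x => EFin (@?f x)) => apply/(@measurable_EFinP _ _ _ _ f)
  | |- measurable_fun _ (fun x => tnth (@?g x) ?i) =>
      apply: (measurableT_comp (@measurable_tnth _ _ _ i) (g := g))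
  | |- measurable_fun _ (fun x => (@?f x).1) => apply: (measurableT_comp measurable_fst (g := f))
  | |- measurable_fun _ (fun x => (@?f x).2) => apply: (measurableT_comp measurable_snd (g := f))
  | |- measurable_fun _ (fun x => x) => exact: measurable_id
  | |- measurable_fun _ (fun x => ?c) => exact: measurable_cst
  end.
Ltac mfun := repeat first
  [ mfun_step | apply: mfun_sum => ? /= | apply: mfun_prod => ? /= ].

(** * Lebesgue integration on tuples *)

Section tuple_integrals.
Context {R : realType}.
Local Notation mR := (measurableTypeR R).
Local Notation mu := (@lebesgue_measure R).
Local Notation L := (@lebesgue_tuple R).

Lemma ge0_tonelli d1 d2 (T1 : measurableType d1) (T2 : measurableType d2)
  (m1 : {sigma_finite_measure set T1 -> \bar R})
  (m2 : {sigma_finite_measure set T2 -> \bar R}) (f : T1 -> T2 -> R) :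
  measurable_fun [set: T1 * T2] (fun z => f z.1 z.2) ->
  (forall x y, 0 <= f x y) ->
  (\int[m1]_x \int[m2]_y (f x y)%:E = \int[m2]_y \int[m1]_x (f x y)%:E)%E.
Proof.
move=> mf f0.
apply: (@fubini_tonelli _ _ _ _ _ m1 m2 (fun z => (f z.1 z.2)%:E)).
  by apply/measurable_EFinP.
by move=> x; rewrite lee_fin.
Qed.

(** The measure with values [`|b| * mu (g @^-1` A)], where [g x = b * x + c], agrees
    with [mu] on half-open intervals, hence everywhere. *)
Lemma ge0_integral_affine (f : mR -> \bar R) (b c : R) : b != 0 ->
  measurable_fun setT f -> (forall x, 0 <= f x)%E ->
  (`|b|%:E * \int[mu]_x f (b * x + c)%R = \int[mu]_x f x)%E.
Proof.
move=> b0 mf f0.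
have nb0 : 0 < `|b| by rewrite normr_gt0.
pose g (x : mR) : mR := b * x + c.
have mg : measurable_fun setT g.
  by rewrite /g; mfun.
pose m0 : {measure set mR -> \bar R} :=
  mscale (NngNum (ltW nb0)) (pushforward mu g).
pose m : {measure set mR -> \bar R} := m0 mg.
have mE A : measurable A -> mu A = m A.
  apply: lebesgue_measure_unique => _ [[x y] /= _ <-].
  rewrite /m/m0/= /mscale/=.
  rewrite -[pushforward mu g _]/(mu (g @^-1` _)).
  have [b0'|b0'] := ltrP 0 b.
    rewrite (_ : g @^-1` _ = [set` `](x - c) / b, (y - c) / b] ]); last first.
      by apply/seteqP; split => z /=; rewrite !in_itv/= /g ltr_pdivrMr// ler_pdivlMr// 
        ltrBlDr lerBrDr mulrC.
    rewrite !lebesgue_measure_itv/= !lte_fin ltr_pM2r ?invr_gt0// ltrBlDr subrK.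
    case: ifPn => _; rewrite ?mule0// -!EFinB -EFinM gtr0_norm//; congr EFin.
    by field.
  have {b0 b0'}b0' : b < 0 by rewrite lt_neqAle b0.
  rewrite (_ : g @^-1` _ = [set` `[(y - c) / b, (x - c) / b[ ]); last first.
    by apply/seteqP; split => z /=; rewrite !in_itv/= /g ltr_ndivlMr// ler_ndivrMr// 
        ltrBlDr lerBrDr [b * z]mulrC andbC.
  rewrite !lebesgue_measure_itv/= !lte_fin ltr_nM2r ?invr_lt0// ltrBlDr subrK.
  case: ifPn => _; rewrite ?mule0// -!EFinB -EFinM ltr0_norm//; congr EFin.
  by field; rewrite lt_eqF.
transitivity (\int[m]_x f x)%E; last first.
  by apply/esym/eq_measure_integral => A mA _; exact: mE.
rewrite /m/m0 ge0_integral_mscale//=; congr (_ * _)%E.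
by rewrite ge0_integral_pushforward.
Qed.

Lemma integral_tuple_cons n (f : n.+1.-tuple mR -> \bar R) :
  measurable_fun setT f -> (forall x, 0 <= f x)%E ->
  (\int[L n.+1]_x f x = \int[mu]_x \int[L n]_t f (pair_cons (x, t)))%E.
Proof.
move=> mf f0.
rewrite -(@fubini_tonelli1 _ _ _ _ _ mu (L n) (f \o (@pair_cons R n)))//; last 2 first.
- exact: (measurableT_comp mf (@measurable_pair_cons R n)).
- by move=> x; exact: f0.
rewrite /= /tuple_prod ge0_integral_pushforward//.
exact: measurable_pair_cons.
Qed.


Lemma tnth_pair_cons0 n (x : mR) (t : n.-tuple mR) : tnth (pair_cons (x, t)) ord0 = x.
Proof. by []. Qed.

Lemma tnth_pair_consS n (x : mR) (t : n.-tuple mR) i :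
  tnth (pair_cons (x, t)) (lift ord0 i) = tnth t i.
Proof. by rewrite tnthS. Qed.

(** The only substitutions used below act on each coordinate separately. *)
Definition tuple_affine n (b c : 'I_n -> R) (t : n.-tuple mR) : n.-tuple mR :=
  [tuple b i * tnth t i + c i | i < n].

Lemma measurable_tuple_affine n (b c : 'I_n -> R) :
  measurable_fun setT (tuple_affine b c).
Proof.
apply/measurable_fun_tnthP => i.
rewrite (_ : _ \o _ = (fun t => b i * tnth t i + c i)); first by mfun.
by apply/funext => t /=; rewrite tnth_mktuple.
Qed.

(** Induction on the dimension: Tonelli's theorem splits off the first coordinate,
    which is then substituted on the line. *)
Lemma integral_tuple_affine n (b c : 'I_n -> R) (f : n.-tuple mR -> \bar R) :
  (forall i, b i != 0) -> measurable_fun setT f -> (forall x, 0 <= f x)%E ->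
  ((\prod_(i < n) `|b i|)%:E * \int[L n]_t f (tuple_affine b c t) =
   \int[L n]_t f t)%E.
Proof.
elim: n b c f => [|n IH] b c f b0 mf f0.
  rewrite big_ord0 mul1e; apply: eq_integral => t _; congr f.
  by apply: eq_from_tnth => -[].
have mfc x : measurable_fun setT (fun t => f (pair_cons (x, t))).
  apply: (measurableT_comp mf).
  by apply: (measurableT_comp (@measurable_pair_cons R n)); exact: measurable_pair1.
have mfa : measurable_fun setT (fun t => f (tuple_affine b c t)).
  exact: (measurableT_comp mf (@measurable_tuple_affine _ b c)).
have mF : measurable_fun setT (fun x : mR => \int[L n]_t f (pair_cons (x, t)))%E.
  apply: (@measurable_fun_fubini_tonelli_F _ _ _ _ _ (L n) (f \o (@pair_cons R n))).
    exact: (measurableT_comp mf (@measurable_pair_cons R n)).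
  by move=> z; exact: f0.
rewrite [X in (_ * X)%E](integral_tuple_cons mfa); last by move=> x; exact: f0.
rewrite [RHS](integral_tuple_cons mf f0).
have F0 (x : mR) : (0 <= \int[L n]_t f (pair_cons (x, t)))%E by exact: integral_ge0.
rewrite -(ge0_integral_affine (c ord0) (b0 ord0) mF F0).
rewrite big_ord_recl EFinM -muleA; congr (_ * _)%E.
rewrite -ge0_integralZl//; last first.
- by rewrite lee_fin prodr_ge0.
- by move=> x _; apply: integral_ge0.
- apply: (@measurable_fun_fubini_tonelli_F _ _ _ _ _ (L n)
    (fun z => f (tuple_affine b c (pair_cons z)))) => //.
  exact: (measurableT_comp mfa (@measurable_pair_cons R n)).
apply: eq_integral => x _.
rewrite -[RHS](IH (fun i => b (lift ord0 i)) (fun i => c (lift ord0 i))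
  (fun t => f (pair_cons (_, t))))//.
congr (_ * _)%E; apply: eq_integral => t _; congr f.
apply: eq_from_tnth => i; rewrite tnth_mktuple.
case: (unliftP ord0 i) => [j ->|->].
  by rewrite !tnth_pair_consS tnth_mktuple.
by rewrite !tnth_pair_cons0.
Qed.

Lemma integral_tuple_prod n (f : 'I_n -> mR -> R) :
  (forall i, measurable_fun setT (f i)) -> (forall i x, 0 <= f i x) ->
  (\int[L n]_t (\prod_(i < n) f i (tnth t i))%:E =
   \prod_(i < n) \int[mu]_x (f i x)%:E)%E.
Proof.
elim: n f => [|n IH] f mf f0.
  under eq_integral do rewrite big_ord0.
  by rewrite big_ord0 integral_cst//= diracT mule1.
rewrite integral_tuple_cons; last 2 first.
- mfun; exact: (measurableT_comp (mf _) (measurable_tnth _)).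
- by move=> t; rewrite lee_fin prodr_ge0.
rewrite big_ord_recl -(IH (fun i => f (lift ord0 i)))//.
rewrite -ge0_integralZr//; last 3 first.
- by apply/measurable_EFinP; exact: mf.
- by move=> x _; rewrite lee_fin.
- by apply: integral_ge0 => t _; rewrite lee_fin prodr_ge0.
apply: eq_integral => x _; rewrite -ge0_integralZl//; last 3 first.
- mfun; exact: (measurableT_comp (mf _) (measurable_tnth _)).
- by move=> t _; rewrite lee_fin prodr_ge0.
- by rewrite lee_fin.
apply: eq_integral => t _; rewrite big_ord_recl -EFinM; congr (_ * _)%:E.
by apply: eq_bigr => i _; rewrite tnth_pair_consS.
Qed.

End tuple_integrals.



(** * Integrals on the line *)

Section line_integrals.
Context {R : realType}.
Local Notation mR := (measurableTypeR R).
Local Notation mu := (@lebesgue_measure R).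

(** Derivatives of functions given with their bound variable displayed. *)
Section pointwise_derivatives.
Implicit Types (f g : R -> R) (x : R).

Lemma is_deriveMl f x (c df : R) :
  is_derive x (1 : R) f df -> is_derive x (1 : R) (fun t => c * f t) (c * df).
Proof. by move=> ?; exact: is_deriveZ. Qed.

Lemma is_deriveXn f n x (df : R) : is_derive x (1 : R) f df ->
  is_derive x (1 : R) (fun t => f t ^+ n.+1) (n.+1%:R * f x ^+ n * df).
Proof.
move=> ?; rewrite (_ : (fun _ => _) = f ^+ n.+1); last first.
  by apply/funext => t; rewrite exprfctE.
exact: is_deriveX.
Qed.

Lemma is_deriveVn f x (df : R) : f x != 0 -> is_derive x (1 : R) f df ->
  is_derive x (1 : R) (fun t => (f t)^-1) (- (f x ^+ 2)^-1 * df).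
Proof. by move=> ? ?; exact: is_deriveV. Qed.

Lemma is_derive_exp f x (df : R) : is_derive x (1 : R) f df ->
  is_derive x (1 : R) (fun t => expR (f t)) (df * expR (f x)).
Proof. by move=> ?; rewrite mulrC; exact: is_derive1_comp. Qed.

Lemma is_derive_bigsum n (h : 'I_n -> R -> R) x (dh : 'I_n -> R) :
  (forall i, is_derive x (1 : R) (h i) (dh i)) ->
  is_derive x (1 : R) (fun t => \sum_(i < n) h i t) (\sum_(i < n) dh i).
Proof.
move=> ?; rewrite (_ : (fun _ => _) = \sum_(i < n) h i); last first.
  by apply/funext => t; rewrite fct_sumE.
exact: is_derive_sum.
Qed.

End pointwise_derivatives.

Lemma integral_iverson (P : R -> bool) (f : R -> R) :
  (\int[mu]_(x in [set x | P x]) (f x)%:E = \int[mu]_x (iverson (P x) * f x)%:E)%E.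
Proof.
rewrite integral_mkcond; apply: eq_integral => x _.
rewrite patchE /iverson; case: (boolP (P x)) => Px.
  by rewrite mem_set// mul1r.
by rewrite memNset ?mul0r//; exact/negP.
Qed.

Lemma ge0_FTC_pinfty (F f : R -> R) (a l : R) :
  (forall x, is_derive x (1 : R) F (f x)) -> continuous f ->
  (forall x, a <= x -> 0 <= f x) -> F x @[x --> +oo] --> l ->
  (\int[mu]_x (iverson (a < x) * f x)%:E = (l - F a)%:E)%E.
Proof.
move=> dF cf f0 Fl.
rewrite -(integral_iverson (fun x => a < x)).
rewrite (_ : [set x | a < x] = `]a, +oo[%classic); last first.
  by apply/seteqP; split => x /=; rewrite in_itv/= andbT.
have cF : continuous F.
  by move=> x; apply: differentiable_continuous; apply/derivable1_diffP; case: (dF x).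
rewrite integral_itv_obnd_cbnd; last first.
  apply/measurable_EFinP; apply: measurable_funTS.
  exact: continuous_measurable_fun.
rewrite EFinB; apply: (@ge0_continuous_FTC2y _ f F) => //.
- exact: continuous_subspaceT.
- by apply: cvg_at_right_filter; exact: cF.
- by move=> x _; rewrite derive1E; apply: derive_val.
Qed.

Lemma FTC_segment (F f : R -> R) (a b : R) : a <= b ->
  (forall x, a <= x <= b -> is_derive x (1 : R) F (f x)) ->
  (forall x, a <= x <= b -> {for x, continuous f}) ->
  (\int[mu]_x (iverson ((a < x) && (x < b)) * f x)%:E = (F b - F a)%:E)%E.
Proof.
rewrite le_eqVlt => /predU1P[<- _ _|ab dF cf].
  rewrite subrr integral0_eq// => x _; rewrite /iverson.
  by have [ax|_] := ltP a x; rewrite ?mul0r// ltNge (ltW ax) mul0r.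
rewrite -(integral_iverson (fun x => (a < x) && (x < b))).
rewrite (_ : [set x | (a < x) && (x < b)] = `]a, b[%classic); last first.
  by apply/seteqP; split => x /=; rewrite in_itv.
have cF x : a <= x <= b -> {for x, continuous F}.
  move=> xab; apply: differentiable_continuous; apply/derivable1_diffP.
  by case: (dF x xab).
have wcf : {within `[a, b], continuous f}.
  apply: continuous_in_subspaceT => x; rewrite inE/= in_itv/= => xab; exact: cf.
rewrite -(@integral_itv_bndoo _ a b (EFin \o f) true false); last first.
  apply/measurable_EFinP; apply: (@measurable_funS _ _ _ _ `[a, b]) => //.
    exact: subset_itv_oo_cc.
  by apply: subspace_continuous_measurable_fun.
rewrite EFinB; apply: continuous_FTC2 => //.
- split.
  + by move=> x; rewrite in_itv/= => /andP[ax xb]; case: (dF x) => //; rewrite !ltW.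
  + by apply: cvg_at_right_filter; apply: cF; rewrite lexx ltW.
  + by apply: cvg_at_left_filter; apply: cF; rewrite lexx ltW.
- move=> x; rewrite in_itv/= => /andP[ax xb].
  by rewrite derive1E; have := dF x; rewrite !ltW// => /(_ isT) ?; apply: derive_val.
Qed.

Lemma integral_expRN (s : R) :
  (\int[mu]_c (iverson (s < c) * expR (- c))%:E = (expR (- s))%:E)%E.
Proof.
have dF (x : R) : is_derive x (1 : R) (fun c => - expR (- c)) (expR (- x)).
  by apply: is_derive_eq; rewrite /GRing.scale/=; ring.
rewrite (ge0_FTC_pinfty (l := 0) dF).
- by rewrite sub0r opprK.
- by move=> x; apply: continuous_comp; [exact: continuousN|exact: continuous_expR].
- by move=> x _; exact: expR_ge0.
- by rewrite -oppr0; apply: cvgN; exact: cvgr_expR.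
Qed.

(** The bracket [0 < c] excludes the endpoint only if [s = 0]; either way the
    difference with [integral_expRN] is a null set. *)
Lemma integral_expRN_ge (s : R) : 0 <= s ->
  (\int[mu]_c (iverson (0 < c) * expR (- c) * iverson (s <= c))%:E
   = (expR (- s))%:E)%E.
Proof.
rewrite le_eqVlt => /predU1P[<-|s0].
  rewrite -integral_expRN; apply: eq_integral => c _.
  by have [c0|c0] := ltP 0 c; rewrite ?iversonF ?mul0r// (ltW c0) iversonT !mul1r mulr1.
rewrite -integral_expRN.
transitivity (\int[mu]_c (iverson (s <= c) * expR (- c))%:E)%E.
  apply: eq_integral => c _; have [sc|sc] := leP s c; last by rewrite iversonF mulr0 mul0r.
  by rewrite (lt_le_trans s0 sc) iversonT mulr1.
rewrite -(integral_iverson (fun c => s <= c)) -(integral_iverson (fun c => s < c)).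
rewrite (_ : [set x | s <= x] = `[s, +oo[%classic); last first.
  by apply/seteqP; split => x /=; rewrite in_itv/= andbT.
rewrite (_ : [set x | s < x] = `]s, +oo[%classic); last first.
  by apply/seteqP; split => x /=; rewrite in_itv/= andbT.
rewrite integral_itv_obnd_cbnd//; apply: measurable_funTS; mfun.
Qed.

Lemma integral_gauss_tail (s : R) : 0 <= s ->
  (\int[mu]_t (iverson (s < t) * (2 * t * expR (- t ^+ 2)))%:E
   = (expR (- s ^+ 2))%:E)%E.
Proof.
move=> s0.
have dF (x : R) : is_derive x (1 : R) (fun t => - expR (- t ^+ 2))
    (2 * x * expR (- x ^+ 2)).
  by apply: is_derive_eq; rewrite /GRing.scale/=; ring.
rewrite (ge0_FTC_pinfty (l := 0) dF).
- by rewrite sub0r opprK.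
- move=> x; apply: continuousM; last exact: continuous_gauss_fun.
  by apply: continuousM => //; exact: cst_continuous.
- by move=> x sx; rewrite !mulr_ge0 ?expR_ge0// (le_trans s0).
- by rewrite -oppr0; apply: cvgN; exact: cvg_gauss_fun.
Qed.

Lemma integral_exprn (t : R) p : 0 <= t ->
  (\int[mu]_s (iverson ((0 < s) && (s < t)) * s ^+ p)%:E
   = (t ^+ p.+1 / p.+1%:R)%:E)%E.
Proof.
move=> t0.
have dF (x : R) : 0 <= x <= t ->
    is_derive x (1 : R) (fun s => p.+1%:R^-1 * s ^+ p.+1) (x ^+ p).
  move=> _.
  apply: is_derive_eq; first exact: (is_deriveMl _ (is_deriveXn _ (is_derive_id _ _))).
  by rewrite mulr1 mulrA mulVf ?mul1r.
rewrite (FTC_segment t0 dF).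
- by rewrite expr0n mulr0 subr0 mulrC.
- by move=> x _; exact: exprn_continuous.
Qed.



(** * Gaussian moments of the half-line *)

Definition gauss_moment p : \bar R :=
  (\int[mu]_s (iverson (0 < s) * (s ^+ p * expR (- s ^+ 2)))%:E)%E.

Lemma gauss_moment_ge0 p : (0 <= gauss_moment p)%E.
Proof.
apply: integral_ge0 => s _; rewrite lee_fin /iverson.
by case: ltP => s0; rewrite ?mul0r// mul1r mulr_ge0 ?expR_ge0 ?exprn_ge0// ltW.
Qed.

Lemma gauss_moment_scale p (rho : R) : 0 < rho ->
  (\int[mu]_s (iverson (0 < s) * (s ^+ p * expR (- (rho * s) ^+ 2)))%:E =
   (rho ^+ p.+1)^-1%:E * gauss_moment p)%E.
Proof.
move=> rho0.
pose g (s : mR) : \bar R := (iverson (0 < s) * (s ^+ p * expR (- s ^+ 2)))%:E.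
have mg : measurable_fun setT g by rewrite /g; mfun.
have g0 s : (0 <= g s)%E.
  rewrite lee_fin /iverson.
  by case: ltP => s0; rewrite ?mul0r// mul1r mulr_ge0 ?expR_ge0 ?exprn_ge0// ltW.
rewrite /gauss_moment -(ge0_integral_affine (b := rho) 0 (lt0r_neq0 rho0) mg g0).
rewrite muleA -EFinM gtr0_norm// exprS invfM mulrAC mulVf ?lt0r_neq0// mul1r.
rewrite -ge0_integralZl//; last 2 first.
- by rewrite /g; mfun.
- by rewrite lee_fin invr_ge0 exprn_ge0// ltW.
apply: eq_integral => s _; rewrite -EFinM; congr EFin.
rewrite addr0 pmulr_rgt0// (exprMn p); field.
by rewrite expf_neq0// lt0r_neq0.
Qed.

(** This is the functional equation of Gamma. Instead of integrating by parts,
    one writes [exp (- s^2)] as the integral of [2 t exp (- t^2)] over [t > s] and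
    integrates in [s] first. *)
Lemma gauss_moment_rec p :
  ((p.+1%:R)%:E * gauss_moment p = 2%:E * gauss_moment p.+2)%E.
Proof.
(* the last bracket makes the integrand nonnegative for all [s] and [t] *)
transitivity (\int[mu]_s \int[mu]_t (iverson (0 < s) * (p.+1%:R * s ^+ p) *
   (iverson (s < t) * (2 * t * expR (- t ^+ 2)) * iverson (0 < t)))%:E)%E.
  rewrite -ge0_integralZl//; last 2 first.
  - by mfun.
  - move=> s _; rewrite lee_fin /iverson; case: ltP => s0; rewrite ?mul0r//.
    by rewrite mul1r mulr_ge0 ?expR_ge0 ?exprn_ge0// ltW.
  apply: eq_integral => s _.
  have [s0|s0] := ltP 0 s; last first.
    rewrite /iverson mul0r mule0 integral0_eq// => t _.
    by rewrite !mul0r.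
  under eq_integral => t _.
    rewrite (_ : (_ * _) = p.+1%:R * s ^+ p * (iverson (s < t) *
        (2 * t * expR (- t ^+ 2)))); last first.
      rewrite /iverson; have [st|_] := ltP s t; last by rewrite !(mul0r, mulr0).
      by rewrite (lt_trans s0 st) !mul1r mulr1.
    rewrite EFinM; over.
  rewrite ge0_integralZl//; last 3 first.
  - by mfun.
  - move=> t _; rewrite lee_fin /iverson; have [st|st] := ltP s t; rewrite ?mul0r// mul1r.
    by rewrite !mulr_ge0 ?expR_ge0// ltW// (lt_trans s0).
  - by rewrite lee_fin mulr_ge0// exprn_ge0// ltW.
  by rewrite integral_gauss_tail 1?ltW// -!EFinM mul1r mulrA.
rewrite ge0_tonelli; last 2 first.
- by mfun.
- move=> s t; rewrite /iverson; have [s0|s0] := ltP 0 s; last by rewrite !mul0r.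
  have [t0|t0] := ltP 0 t; last by rewrite !mulr0.
  by rewrite !mulr_ge0 ?exprn_ge0 ?expR_ge0// ltW.
rewrite -ge0_integralZl//; last 2 first.
- by mfun.
- move=> s _; rewrite lee_fin /iverson; case: ltP => s0; rewrite ?mul0r//.
  by rewrite mul1r mulr_ge0 ?expR_ge0 ?exprn_ge0// ltW.
apply: eq_integral => t _.
have [t0|t0] := ltP 0 t; last first.
  rewrite /iverson mul0r mule0 integral0_eq// => s _.
  by rewrite !mulr0.
under eq_integral => s _.
  rewrite (_ : (_ * _) = p.+1%:R * (2 * t * expR (- t ^+ 2)) *
    (iverson ((0 < s) && (s < t)) * s ^+ p)); last first.
    by rewrite iversonM iversonT; ring.
  rewrite EFinM; over.
rewrite ge0_integralZl//; last 3 first.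
- by mfun.
- move=> s _; rewrite lee_fin iversonM /iverson; have [s0|s0] := ltP 0 s; rewrite ?mul0r//.
  by rewrite !mulr_ge0// exprn_ge0// ltW.
- by rewrite lee_fin !mulr_ge0// ?expR_ge0// ltW.
rewrite (_ : (\int[mu]_x _)%E = (t ^+ p.+1 / p.+1%:R)%:E).
  by rewrite -!EFinM iversonT; congr EFin; rewrite !exprS; field.
exact/integral_exprn/ltW.
Qed.


Lemma gauss_moment1 : gauss_moment 1 = 2^-1%:E.
Proof.
have := @integral_gauss_tail 0 (lexx 0).
rewrite expr0n oppr0 expR0 => gE.
rewrite -[LHS]mul1e -(_ : 2^-1%:E * 2%:E = 1)%E; last by rewrite -EFinM mulVf.
rewrite -muleA; rewrite (_ : _ * gauss_moment 1 = 1)%E ?mule1//.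
rewrite -gE -ge0_integralZl//; last 2 first.
- by mfun.
- move=> s _; rewrite lee_fin /iverson; case: ltP => s0; rewrite ?mul0r//.
  by rewrite mul1r mulr_ge0 ?expR_ge0// ltW.
apply: eq_integral => t _; rewrite -EFinM; congr EFin; rewrite expr1; ring.
Qed.

Lemma gauss_moment0 : gauss_moment 0 = (Num.sqrt pi / 2)%:E.
Proof.
rewrite -integral0y_gauss -integral_itv_obnd_cbnd; last first.
  by apply/measurable_EFinP/measurable_funTS; exact: measurable_gauss_fun.
rewrite (_ : `]0, +oo[%classic = [set x | 0 < x]); last first.
  by apply/seteqP; split => x /=; rewrite in_itv/= andbT.
rewrite (integral_iverson (fun x => 0 < x)).
by apply: eq_integral => x _; rewrite expr0 mul1r.
Qed.

(** The recursion has step two, hence the induction on two consecutive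
    moments. *)
Lemma gauss_moment_fin_gt0 p : exists2 r : R, 0 < r & gauss_moment p = r%:E.
Proof.
suff [] : (exists2 r : R, 0 < r & gauss_moment p = r%:E) /\
  (exists2 r : R, 0 < r & gauss_moment p.+1 = r%:E) by [].
elim: p => [|p [[r r0 rE] IH]]; split => //.
- by exists (Num.sqrt pi / 2); [rewrite divr_gt0// sqrtr_gt0 pi_gt0|exact: gauss_moment0].
- by exists 2^-1; [rewrite invr_gt0|exact: gauss_moment1].
- exists (p.+1%:R / 2 * r); first by rewrite mulr_gt0// divr_gt0.
  rewrite -[LHS]mul1e -(_ : 2^-1%:E * 2%:E = 1)%E; last by rewrite -EFinM mulVf.
  by rewrite -muleA -gauss_moment_rec rE -!EFinM; congr EFin; ring.
Qed.

Definition gauss_momentR p : R := fine (gauss_moment p).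

Lemma gauss_momentE p : gauss_moment p = (gauss_momentR p)%:E.
Proof. by rewrite /gauss_momentR; have [r _ ->] := gauss_moment_fin_gt0 p. Qed.

Lemma gauss_momentR_gt0 p : 0 < gauss_momentR p.
Proof. by rewrite /gauss_momentR; have [r r0 ->] := gauss_moment_fin_gt0 p. Qed.

Lemma gauss_momentR_rec p :
  p.+1%:R * gauss_momentR p = 2 * gauss_momentR p.+2.
Proof. by have := gauss_moment_rec p; rewrite !gauss_momentE -!EFinM => -[]. Qed.

(** The substitution [c = s^2] without substitution: for [p > 0], [sqrt c ^ p] is
    the integral of [p s^(p - 1)] over [0 < s < sqrt c], and [exp (- c)] integrates
    over [c > s^2] to [exp (- s^2)]. *)
Lemma integral_sqrt_expR p :
  (\int[mu]_c (iverson (0 < c) * (Num.sqrt c ^+ p * expR (- c)))%:E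
   = (2 * gauss_momentR p.+1)%:E)%E.
Proof.
case: p => [|p].
  under eq_integral => c _ do rewrite expr0 mul1r.
  rewrite integral_expRN oppr0 expR0 /gauss_momentR gauss_moment1/=.
  by rewrite mulfV.
rewrite -gauss_momentR_rec EFinM -gauss_momentE.
transitivity (\int[mu]_s \int[mu]_c (iverson (0 < s) * (p.+1%:R * s ^+ p) *
   (iverson (s ^+ 2 < c) * expR (- c)))%:E)%E; last first.
  rewrite -ge0_integralZl//; last 2 first.
  - by mfun.
  - move=> s _; rewrite lee_fin /iverson; case: ltP => s0; rewrite ?mul0r//.
    by rewrite mul1r mulr_ge0 ?expR_ge0 ?exprn_ge0// ltW.
  apply: eq_integral => s _.
  under eq_integral do rewrite EFinM.
  rewrite ge0_integralZl//; last 3 first.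
  - by mfun.
  - by move=> c _; rewrite lee_fin mulr_ge0// expR_ge0.
  - rewrite lee_fin /iverson; case: ltP => s0; rewrite ?mul0r//.
    by rewrite mul1r mulr_ge0 ?exprn_ge0// ltW.
  by rewrite integral_expRN -!EFinM; congr EFin; ring.
rewrite ge0_tonelli; last 2 first.
- by mfun.
- move=> s c; have [s0|s0] := ltP 0 s; last by rewrite iversonF !mul0r.
  by rewrite !mulr_ge0 ?expR_ge0 ?exprn_ge0// ltW.
apply: eq_integral => c _.
have [c0|c0] := ltP 0 c; last first.
  rewrite iversonF mul0r integral0_eq// => s _.
  by rewrite [s ^+ 2 < c]le_gtF ?iversonF ?mul0r ?mulr0// (le_trans c0) ?sqr_ge0.
under eq_integral => s _.
  rewrite (_ : (_ * _) = p.+1%:R * expR (- c) *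
    (iverson ((0 < s) && (s < Num.sqrt c)) * s ^+ p)); last first.
    rewrite iversonM; have [s0|s0] := ltP 0 s; last by rewrite iversonF !(mul0r, mulr0).
    rewrite (_ : (s ^+ 2 < c) = (s < Num.sqrt c)); first by ring.
    by rewrite -[in LHS](sqr_sqrtr (ltW c0)) ltr_pXn2r// nnegrE ?sqrtr_ge0 ?ltW.
  rewrite EFinM; over.
rewrite ge0_integralZl//; last 2 first.
- by mfun.
- move=> s _; rewrite lee_fin iversonM /iverson; have [s0|s0] := ltP 0 s; rewrite ?mul0r//.
  by rewrite !mulr_ge0// exprn_ge0// ltW.
rewrite integral_exprn ?sqrtr_ge0// -!EFinM; congr EFin; rewrite iversonT.
by field.
Qed.

Lemma GammaE p : Gamma (p%:R / 2 + 1) = 2 * gauss_momentR p.+1 :> R.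
Proof.
rewrite /Gamma /Rintegral (_ : `]0, +oo[%classic = [set x | 0 < x]); last first.
  by apply/seteqP; split => x /=; rewrite in_itv/= andbT.
rewrite (integral_iverson (fun x => 0 < x)).
rewrite -[RHS]/(fine (2 * gauss_momentR p.+1)%:E) -integral_sqrt_expR; congr fine.
apply: eq_integral => c _; rewrite /iverson; have [c0|] := ltP 0 c; rewrite ?mul0r// !mul1r.
rewrite addrK; congr (_ * _)%:E.
by rewrite mulrC powRrM powR12_sqrt ?ltW// powR_mulrn ?sqrtr_ge0.
Qed.

Lemma integral_sqr_gauss :
  (\int[mu]_x (x ^+ 2 * expR (- x ^+ 2))%:E = (Num.sqrt pi / 2)%:E)%E.
Proof.
rewrite (@ge0_symfun_integralT _ (fun x : R => x ^+ 2 * expR (- x ^+ 2)))/=; last 3 first.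
- by move=> x; rewrite mulr_ge0 ?expR_ge0 ?sqr_ge0.
- move=> x; apply: cvgM; last exact: continuous_gauss_fun.
  exact: exprn_continuous.
- by move=> x /=; rewrite sqrrN.
rewrite -gauss_moment0 -[RHS]mul1e (gauss_moment_rec 0); congr (_ * _)%E.
rewrite (_ : [set x | _] = `[0, +oo[%classic); last first.
  by apply/seteqP; split => x/=; rewrite in_itv/= andbT.
rewrite -integral_itv_obnd_cbnd; last first.
  by apply: measurable_funTS; mfun.
rewrite (_ : `]0, +oo[%classic = [set x | 0 < x]); last first.
  by apply/seteqP; split => x /=; rewrite in_itv/= andbT.
by rewrite (integral_iverson (fun x => 0 < x)).
Qed.

End line_integrals.


(** * Gaussian integrals on tuples *)

Lemma ge0_integralZl_real d (T : measurableType d) (R : realType)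
  (m : {measure set T -> \bar R}) (c : R) (f : T -> R) : 0 <= c ->
  measurable_fun setT f -> (forall x, 0 <= f x) ->
  (\int[m]_x (c * f x)%:E = c%:E * \int[m]_x (f x)%:E)%E.
Proof.
move=> c0 mf f0; under eq_integral do rewrite EFinM.
rewrite ge0_integralZl//; first exact/measurable_EFinP.
by move=> x _; rewrite lee_fin.
Qed.

Section gaussian.
Context {R : realType}.
Local Notation mR := (measurableTypeR R).
Local Notation mu := (@lebesgue_measure R).
Local Notation L := (@lebesgue_tuple R).

Definition sqnorm n (v : n.-tuple mR) : R := \sum_(i < n) tnth v i ^+ 2.

(** [sqnorm v] is [|v|^2], and [wsqnorm a v] is [|a v|^2], the square of the support
    function of the ellipsoid at [v]. *)
Definition wsqnorm n (a : 'I_n -> R) (v : n.-tuple mR) : R :=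
  \sum_(i < n) a i ^+ 2 * tnth v i ^+ 2.

Lemma measurable_sqnorm n : measurable_fun setT (@sqnorm n).
Proof. rewrite /sqnorm; mfun. Qed.

Lemma measurable_wsqnorm n (a : 'I_n -> R) : measurable_fun setT (wsqnorm a).
Proof. rewrite /wsqnorm; mfun. Qed.

Lemma sqnorm_ge0 n (v : n.-tuple mR) : 0 <= sqnorm v.
Proof. by apply: sumr_ge0 => i _; exact: sqr_ge0. Qed.

Lemma wsqnorm_ge0 n (a : 'I_n -> R) (v : n.-tuple mR) : 0 <= wsqnorm a v.
Proof. by apply: sumr_ge0 => i _; rewrite mulr_ge0 ?sqr_ge0. Qed.

Lemma integral_gauss_tuple n :
  (\int[L n]_v (expR (- sqnorm v))%:E = (Num.sqrt pi ^+ n)%:E)%E.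
Proof.
under eq_integral do rewrite /sqnorm -sumrN expR_sum.
rewrite (@integral_tuple_prod _ _ (fun _ x => expR (- x ^+ 2))); last 2 first.
- by move=> _; mfun.
- by move=> _ x; exact: expR_ge0.
under eq_bigr do rewrite (_ : (\int[mu]_x _)%E = (Num.sqrt pi)%:E) ?integralT_gauss//.
by rewrite prodEFin prodr_const card_ord.
Qed.

Lemma integral_sqr_gauss_tuple n (j : 'I_n) :
  (\int[L n]_v (tnth v j ^+ 2 * expR (- sqnorm v))%:E =
   (Num.sqrt pi ^+ n / 2)%:E)%E.
Proof.
pose f (i : 'I_n) (x : mR) : R := (if i == j then x ^+ 2 else 1) * expR (- x ^+ 2).
transitivity (\int[L n]_v (\prod_(i < n) f i (tnth v i))%:E)%E.
  apply: eq_integral => v _; rewrite /sqnorm -sumrN expR_sum /f big_split/=.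
  by rewrite -big_mkcond/= big_pred1_eq.
rewrite integral_tuple_prod; last 2 first.
- by move=> i; rewrite /f; case: (i == j); mfun.
- by move=> i x; rewrite /f mulr_ge0 ?expR_ge0//; case: (i == j); rewrite ?sqr_ge0.
rewrite (bigD1 j)//= {1}/f eqxx integral_sqr_gauss.
under eq_bigr => i /negbTE ij.
  rewrite (_ : (\int[mu]_x _)%E = (Num.sqrt pi)%:E); first over.
  by rewrite -integralT_gauss; apply: eq_integral => x _; rewrite /f ij mul1r.
rewrite prodEFin -EFinM; congr EFin; rewrite mulrAC; congr (_ / 2).
rewrite prodr_const cardC1 card_ord -exprS.
by congr (_ ^+ _); case: n j {f} => // -[].
Qed.

Lemma integral_wgauss_tuple n (j : 'I_n) (b : 'I_n -> R) : (forall i, 0 < b i) ->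
  (\int[L n]_v (tnth v j ^+ 2 * expR (- \sum_(i < n) b i * tnth v i ^+ 2))%:E =
   (Num.sqrt pi ^+ n / 2 / (b j * \prod_(i < n) Num.sqrt (b i)))%:E)%E.
Proof.
move=> b0.
have sb0 i : 0 < Num.sqrt (b i) by rewrite sqrtr_gt0.
have p0 : 0 < \prod_(i < n) Num.sqrt (b i) by rewrite prodr_gt0.
rewrite [in RHS]mulrC EFinM -(integral_sqr_gauss_tuple j).
rewrite -(@integral_tuple_affine _ _ (fun i => Num.sqrt (b i)) (fun _ => 0)
  (fun v => (tnth v j ^+ 2 * expR (- sqnorm v))%:E)); last 3 first.
- by move=> i; rewrite gt_eqF.
- by rewrite /sqnorm; mfun.
- by move=> v; rewrite lee_fin mulr_ge0 ?sqr_ge0 ?expR_ge0.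
under [in RHS]eq_integral => v _.
  rewrite tnth_mktuple addr0 exprMn sqr_sqrtr ?ltW// -mulrA.
  rewrite (_ : sqnorm _ = \sum_(i < n) b i * tnth v i ^+ 2); last first.
    apply: eq_bigr => i _; rewrite tnth_mktuple addr0 exprMn sqr_sqrtr ?ltW//.
  over.
rewrite ge0_integralZl_real/=; last 3 first.
- exact: ltW.
- by mfun.
- by move=> v; rewrite mulr_ge0 ?sqr_ge0 ?expR_ge0.
rewrite muleA muleA -!EFinM [X in (X * _)%E](_ : _ = 1%E) ?mul1e//; congr EFin.
under [X in _ * X * _]eq_bigr do rewrite gtr0_norm//.
by field; rewrite !gt_eqF.
Qed.

Lemma integral_tuple_scale n (c : R) (f : n.-tuple mR -> \bar R) : 0 < c ->
  measurable_fun setT f -> (forall x, 0 <= f x)%E ->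
  (\int[L n]_v f (tuple_affine (fun _ => c) (fun _ => 0%R) v) =
   (c ^+ n)^-1%:E * \int[L n]_v f v)%E.
Proof.
move=> c0 mf f0; rewrite -[in RHS](@integral_tuple_affine _ _ (fun=> c) (fun=> 0))//; last first.
  by move=> _; rewrite gt_eqF.
rewrite prodr_const card_ord gtr0_norm// muleA -EFinM mulVf ?mul1e//.
by rewrite expf_neq0// gt_eqF.
Qed.


Lemma sqnorm_scale n (c : R) (v : n.-tuple mR) :
  sqnorm (tuple_affine (fun _ => c) (fun _ => 0) v) = c ^+ 2 * sqnorm v.
Proof.
by rewrite /sqnorm mulr_sumr; apply: eq_bigr => i _; rewrite tnth_mktuple addr0 exprMn.
Qed.

Lemma wsqnorm_scale n (a : 'I_n -> R) (c : R) (v : n.-tuple mR) :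
  wsqnorm a (tuple_affine (fun _ => c) (fun _ => 0) v) = c ^+ 2 * wsqnorm a v.
Proof.
rewrite /wsqnorm mulr_sumr; apply: eq_bigr => i _.
by rewrite tnth_mktuple addr0 exprMn mulrCA.
Qed.

Lemma sqnorm_gt0 n (j : 'I_n) (v : n.-tuple mR) : tnth v j != 0 -> 0 < sqnorm v.
Proof.
move=> vj; rewrite /sqnorm (bigD1 j)//= ltr_wpDr ?exprn_even_gt0//.
by apply: sumr_ge0 => i _; exact: sqr_ge0.
Qed.

Lemma wsqnorm_gt0 n (a : 'I_n -> R) (j : 'I_n) (v : n.-tuple mR) :
  0 < a j -> tnth v j != 0 -> 0 < wsqnorm a v.
Proof.
move=> aj vj; rewrite /wsqnorm (bigD1 j)//= ltr_wpDr//.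
  by apply: sumr_ge0 => i _; rewrite mulr_ge0 ?sqr_ge0.
by apply: mulr_gt0; [exact: exprn_gt0|rewrite exprn_even_gt0].
Qed.

(** * Radial integrals *)

Lemma radial_integrand_ge0 n (a : 'I_n -> R) (j : 'I_n) k l (v : n.-tuple mR) :
  0 <= tnth v j ^+ 2 * Num.sqrt (sqnorm v) ^+ k
     / Num.sqrt (wsqnorm a v) ^+ l * expR (- sqnorm v).
Proof.
apply: mulr_ge0; last exact: expR_ge0.
apply: divr_ge0; last by rewrite exprn_ge0 ?sqrtr_ge0.
by apply: mulr_ge0; [exact: sqr_ge0|rewrite exprn_ge0 ?sqrtr_ge0].
Qed.

(** The sum of the [1 / a_i] serves as a convenient upper bound of their
    maximum. *)
Lemma inv_le_sum_inv n (a : 'I_n -> R) i : (forall i, 0 < a i) ->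
  (a i)^-1 <= \sum_(j < n) (a j)^-1.
Proof.
move=> a0; rewrite (bigD1 i)//= lerDl; apply: sumr_ge0 => j _.
by rewrite invr_ge0 ltW.
Qed.

(** The factor [v_j^2] makes the integrand vanish at [v = 0], where the quotient has
    its default value. *)
Definition radial_integral n (a : 'I_n -> R) (j : 'I_n) k l : \bar R :=
  (\int[L n]_v (tnth v j ^+ 2 * Num.sqrt (sqnorm v) ^+ k
     / Num.sqrt (wsqnorm a v) ^+ l * expR (- sqnorm v))%:E)%E.

Definition ellipsoid_integral n (a : 'I_n -> R) (j : 'I_n) p : \bar R :=
  (\int[mu]_t (iverson (0 < t) * (t ^+ p /
    ((a j ^+ 2 * t ^+ 2 + 1) *
         \prod_(i < n) Num.sqrt (a i ^+ 2 * t ^+ 2 + 1))))%:E)%E.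

(** Half of a value of Euler's Beta function. Only its occurrence on both sides of
    [radial_integral_beta] and [gauss_momentM] matters: it cancels. *)
Definition beta_integral p q : \bar R :=
  (\int[mu]_t (iverson (0 < t) * (t ^+ p * (Num.sqrt (1 + t ^+ 2) ^+ q)^-1))%:E)%E.

(** [|a v|^-(p+1)] times the Gaussian moment is the integral of
    [t^p exp (- t^2 |a v|^2)]. Exchanging the integrals leaves a Gaussian integral
    in [v] with variances governed by [1 + a_i^2 t^2]. *)
Lemma radial_integral_gauss n (a : 'I_n -> R) (j : 'I_n) p :
  (forall i, 0 < a i) ->
  (radial_integral a j 0 p.+1 * gauss_moment p =
   (Num.sqrt pi ^+ n / 2)%:E * ellipsoid_integral a j p)%E.
Proof.
move=> a0.
have mN := @measurable_sqnorm n; have mA := @measurable_wsqnorm n a.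
transitivity (\int[L n]_v \int[mu]_t ((tnth v j ^+ 2 * expR (- sqnorm v)) *
    (iverson (0 < t) * (t ^+ p * expR (- (t ^+ 2 * wsqnorm a v)))))%:E)%E.
  rewrite /radial_integral -ge0_integralZr//=; last 3 first.
  - by mfun.
  - by move=> v _; rewrite lee_fin radial_integrand_ge0.
  - exact: gauss_moment_ge0.
  apply: eq_integral => v _.
  rewrite ge0_integralZl_real; last 3 first.
  - by rewrite mulr_ge0 ?sqr_ge0 ?expR_ge0.
  - by mfun.
  - move=> t; have [t0|t0] := ltP 0 t; last by rewrite iversonF mul0r.
    by rewrite !mulr_ge0 ?expR_ge0 ?exprn_ge0// ltW.
  have [vj0|vj0] := eqVneq (tnth v j) 0.
    by rewrite vj0 expr0n/= !mul0r !mul0e.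
  have A0 := wsqnorm_gt0 (a0 j) vj0.
  under eq_integral => t _.
    rewrite -{1}(sqr_sqrtr (ltW A0)) -exprMn [t * _]mulrC; over.
  rewrite gauss_moment_scale ?sqrtr_gt0// muleA -EFinM.
  by congr (_%:E * _)%E; rewrite expr0 mulr1; ring.
rewrite ge0_tonelli; last 2 first.
- mfun; rewrite /wsqnorm /sqnorm; mfun.
- move=> v t; apply: mulr_ge0; first by rewrite mulr_ge0 ?sqr_ge0 ?expR_ge0.
  have [t0|t0] := ltP 0 t; last by rewrite iversonF mul0r.
  by rewrite !mulr_ge0 ?expR_ge0 ?exprn_ge0// ltW.
rewrite /ellipsoid_integral -ge0_integralZl_real; last 3 first.
- by rewrite divr_ge0// exprn_ge0 ?sqrtr_ge0.
- by mfun.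
- move=> t; have [t0|t0] := ltP 0 t; last by rewrite iversonF mul0r.
  rewrite mul1r divr_ge0 ?exprn_ge0 ?(ltW t0)// mulr_ge0//.
    by apply: addr_ge0 => //; apply: mulr_ge0; exact: sqr_ge0.
  by apply: prodr_ge0 => i _; exact: sqrtr_ge0.
apply: eq_integral => t _.
under eq_integral => v _.
  rewrite (_ : _ * _ = (iverson (0 < t) * t ^+ p) * (tnth v j ^+ 2 *
    expR (- \sum_(i < n) (a i ^+ 2 * t ^+ 2 + 1) * tnth v i ^+ 2))); last first.
    rewrite (_ : \sum_(i < n) _ = sqnorm v + t ^+ 2 * wsqnorm a v).
      by rewrite opprD expRD; ring.
    rewrite /sqnorm /wsqnorm mulr_sumr -big_split/=.
    by apply: eq_bigr => i _; ring.
  over.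
rewrite ge0_integralZl_real; last 3 first.
- have [t0|t0] := ltP 0 t; last by rewrite iversonF mul0r.
  by rewrite mul1r exprn_ge0// ltW.
- by mfun.
- by move=> v; rewrite mulr_ge0 ?sqr_ge0 ?expR_ge0.
rewrite integral_wgauss_tuple.
  by rewrite -EFinM; congr EFin; ring.
by move=> i; rewrite ltr_wpDl// mulr_ge0 ?sqr_ge0.
Qed.

(** Substituting [s = |v| t] in the moment brings in the factor [|v|^(p+1)] and turns
    the Gaussian weight into [exp (- (1 + t^2) |v|^2)]. As the rest of the
    integrand is homogeneous of degree 2 in [v], dilating [v] by
    [sqrt (1 + t^2)] separates the variables. *)
Lemma radial_integral_beta n (a : 'I_n -> R) (j : 'I_n) p :
  (forall i, 0 < a i) ->
  (radial_integral a j 0 p.+1 * gauss_moment p =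
   radial_integral a j p.+1 p.+1 * beta_integral p n.+2)%E.
Proof.
move=> a0.
have mN := @measurable_sqnorm n; have mA := @measurable_wsqnorm n a.
transitivity (\int[L n]_v \int[mu]_t ((tnth v j ^+ 2 * Num.sqrt (sqnorm v) ^+ p.+1 /
    Num.sqrt (wsqnorm a v) ^+ p.+1 * expR (- sqnorm v)) *
    (iverson (0 < t) * (t ^+ p * expR (- (t ^+ 2 * sqnorm v)))))%:E)%E.
  rewrite /radial_integral -ge0_integralZr//=; last 3 first.
  - by mfun.
  - by move=> v _; rewrite lee_fin radial_integrand_ge0.
  - exact: gauss_moment_ge0.
  apply: eq_integral => v _.
  rewrite ge0_integralZl_real; last 3 first.
  - exact: radial_integrand_ge0.
  - by mfun.
  - move=> t; have [t0|t0] := ltP 0 t; last by rewrite iversonF mul0r.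
    by rewrite !mulr_ge0 ?expR_ge0 ?exprn_ge0// ltW.
  have [vj0|vj0] := eqVneq (tnth v j) 0.
    by rewrite vj0 expr0n/= !mul0r !mul0e.
  have N0 := sqnorm_gt0 vj0.
  under eq_integral => t _.
    rewrite -{1}(sqr_sqrtr (ltW N0)) -exprMn [t * _]mulrC; over.
  rewrite gauss_moment_scale ?sqrtr_gt0// muleA -EFinM.
  have sN0 : Num.sqrt (sqnorm v) ^+ p.+1 != 0.
    by rewrite expf_neq0// gt_eqF// sqrtr_gt0.
  congr (_%:E * _)%E; rewrite expr0 mulr1.
  set z := (Num.sqrt (wsqnorm a v) ^+ p.+1)^-1; set x := _ ^+ p.+1 in sN0 *.
  by field.
rewrite ge0_tonelli; last 2 first.
- mfun; rewrite /wsqnorm /sqnorm; mfun.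
- move=> v t; apply: mulr_ge0.
    exact: radial_integrand_ge0.
  have [t0|t0] := ltP 0 t; last by rewrite iversonF mul0r.
  by rewrite !mulr_ge0 ?expR_ge0 ?exprn_ge0// ltW.
rewrite muleC /beta_integral -ge0_integralZr//=; last 3 first.
- by mfun.
- move=> t _; have [t0|t0] := ltP 0 t; last by rewrite iversonF mul0r.
  by rewrite lee_fin mul1r mulr_ge0 ?invr_ge0 ?exprn_ge0 ?sqrtr_ge0 ?(ltW t0).
- apply: integral_ge0 => v _.
  by rewrite lee_fin radial_integrand_ge0.
apply: eq_integral => t _.
pose c := Num.sqrt (1 + t ^+ 2).
have c2 : c ^+ 2 = 1 + t ^+ 2 by rewrite sqr_sqrtr// addr_ge0// sqr_ge0.
have c0 : 0 < c by rewrite sqrtr_gt0 ltr_wpDr// sqr_ge0.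
pose G (v : n.-tuple mR) : \bar R := (tnth v j ^+ 2 * Num.sqrt (sqnorm v) ^+ p.+1
     / Num.sqrt (wsqnorm a v) ^+ p.+1 * expR (- sqnorm v))%:E.
have G0 v : (0 <= G v)%E.
  by rewrite lee_fin radial_integrand_ge0.
have mG : measurable_fun setT G by rewrite /G; mfun.
transitivity (\int[L n]_v ((iverson (0 < t) * (t ^+ p * (c ^+ 2)^-1))%:E *
    G (tuple_affine (fun _ => c) (fun _ => 0%R) v)))%E.
  apply: eq_integral => v _; rewrite /G sqnorm_scale wsqnorm_scale tnth_mktuple addr0.
  rewrite !(sqrtrM _ (sqr_ge0 c)) sqrtr_sqr gtr0_norm// !exprMn c2.
  rewrite (_ : - ((1 + t ^+ 2) * _) = - sqnorm v - t ^+ 2 * sqnorm v); last by ring.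
  rewrite expRD -EFinM; congr EFin.
  have cp0 : c ^+ p.+1 != 0 by rewrite expf_neq0// gt_eqF.
  have c20 : 1 + t ^+ 2 != 0 by rewrite -c2 expf_neq0// gt_eqF.
  rewrite (invfM (c ^+ p.+1)).
  set x := c ^+ p.+1 in cp0 *; set y := 1 + t ^+ 2 in c20 *; set z := (Num.sqrt (wsqnorm a v) ^+ p.+1)^-1.
  by field; rewrite cp0 c20.
rewrite ge0_integralZl; last 4 first.
- exact: measurableT.
- exact: (measurableT_comp mG (@measurable_tuple_affine _ _ _ _)).
- by move=> v _; exact: G0.
- have [t0|t0] := ltP 0 t; last by rewrite iversonF mul0r.
  by rewrite lee_fin mul1r mulr_ge0 ?invr_ge0 ?exprn_ge0 ?sqrtr_ge0 ?(ltW t0).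
rewrite integral_tuple_scale// muleA -EFinM; congr (_%:E * _)%E.
by rewrite -/c -(addn2 n) exprD (invfM (c ^+ n)); ring.
Qed.

(** The relation between Gamma and Beta, by the substitution [t = s u] in the
    product of two moments. *)
Lemma gauss_momentM p q :
  (gauss_moment p * gauss_moment q =
   @gauss_moment R (p + q).+1 * beta_integral p (p + q).+2)%E.
Proof.
transitivity (\int[mu]_s \int[mu]_t ((iverson (0 < s) * (s ^+ (p + q).+1 *
    expR (- s ^+ 2))) *
    (iverson (0 < t) * (t ^+ p * expR (- (s * t) ^+ 2))))%:E)%E.
  rewrite muleC [in LHS]/gauss_moment -ge0_integralZr//=; last 3 first.
  - by mfun.
  - move=> s _; have [s0|s0] := ltP 0 s; last by rewrite iversonF mul0r.
    by rewrite lee_fin !mulr_ge0 ?expR_ge0 ?exprn_ge0// ltW.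
  - exact: gauss_moment_ge0.
  apply: eq_integral => s _.
  have [s0|s0] := ltP 0 s; last first.
    by rewrite !iversonF mul0r mul0e integral0_eq// => t _; rewrite !mul0r.
  rewrite ge0_integralZl_real; last 3 first.
  - by rewrite !mulr_ge0 ?expR_ge0 ?exprn_ge0// ltW.
  - by mfun.
  - move=> t; have [t0|t0] := ltP 0 t; last by rewrite iversonF mul0r.
    by rewrite !mulr_ge0 ?expR_ge0 ?exprn_ge0// ltW.
  rewrite (gauss_moment_scale p s0).
  rewrite muleA.
  rewrite -EFinM.
  congr (_%:E * _)%E.
  rewrite iversonT !mul1r.
  rewrite -addSn.
  rewrite (exprD s p.+1).
  set x := s ^+ p.+1; have x0 : x != 0 by rewrite expf_neq0// gt_eqF.
  by field.
rewrite ge0_tonelli; last 2 first.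
- by mfun.
- move=> s t; have [s0|s0] := ltP 0 s; last by rewrite !iversonF !mul0r.
  have [t0|t0] := ltP 0 t; last by rewrite !iversonF mul0r mulr0.
  by rewrite !mulr_ge0 ?expR_ge0 ?exprn_ge0// ltW.
rewrite muleC /beta_integral -ge0_integralZr//=; last 3 first.
- by mfun.
- move=> t _; have [t0|t0] := ltP 0 t; last by rewrite iversonF mul0r.
  by rewrite lee_fin mul1r mulr_ge0 ?invr_ge0 ?exprn_ge0 ?sqrtr_ge0 ?(ltW t0).
- exact: gauss_moment_ge0.
apply: eq_integral => t _.
pose c := Num.sqrt (1 + t ^+ 2).
have c2 : c ^+ 2 = 1 + t ^+ 2 by rewrite sqr_sqrtr// addr_ge0// sqr_ge0.
have c0 : 0 < c by rewrite sqrtr_gt0 ltr_wpDr// sqr_ge0.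
under eq_integral => s _.
  rewrite (_ : _ * _ = (iverson (0 < t) * t ^+ p) * (iverson (0 < s) *
    (s ^+ (p + q).+1 * expR (- (c * s) ^+ 2)))); last first.
    rewrite (exprMn 2 c) c2 (_ : - ((1 + t ^+ 2) * _) = - s ^+ 2 - (s * t) ^+ 2); last by ring.
    by rewrite expRD; ring.
  over.
rewrite ge0_integralZl_real; last 3 first.
- have [t0|t0] := ltP 0 t; last by rewrite iversonF mul0r.
  by rewrite mul1r exprn_ge0// ltW.
- by mfun.
- move=> s; have [s0|s0] := ltP 0 s; last by rewrite iversonF mul0r.
  by rewrite !mulr_ge0 ?expR_ge0 ?exprn_ge0// ltW.
by rewrite gauss_moment_scale// muleA -EFinM mulrA.
Qed.

End gaussian.


(** * Layer integrals *)

Section layers.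
Context {R : realType}.
Local Notation mR := (measurableTypeR R).
Local Notation mu := (@lebesgue_measure R).
Local Notation L := (@lebesgue_tuple R).

(** The contribution of the monomial [l^p v_j^2] to the Gaussian-weighted volume;
    the second bracket is the condition [l |a v| < |v|]. *)
Definition layer_integrand n (a : 'I_n -> R) (j : 'I_n) p (l : mR) (v : n.-tuple mR) : R :=
  iverson (0 < l) * l ^+ p * (iverson (l ^+ 2 * wsqnorm a v < sqnorm v) *
    (tnth v j ^+ 2 * expR (- sqnorm v))).

Lemma layer_integrand_ge0 n (a : 'I_n -> R) (j : 'I_n) p l v :
  0 <= layer_integrand a j p l v.
Proof.
apply: mulr_ge0; last by apply: mulr_ge0 => //; rewrite mulr_ge0 ?sqr_ge0 ?expR_ge0.
have [l0|l0] := ltP 0 l; last by rewrite iversonF mul0r.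
by rewrite mul1r exprn_ge0 ?ltW.
Qed.

Lemma measurable_layer_integrand n (a : 'I_n -> R) (j : 'I_n) p :
  measurable_fun [set: mR * n.-tuple mR] (fun z => layer_integrand a j p z.1 z.2).
Proof. by rewrite /layer_integrand /wsqnorm /sqnorm; mfun. Qed.

Definition layer_integral n (a : 'I_n -> R) (j : 'I_n) p : \bar R :=
  (\int[mu]_l \int[L n]_v (layer_integrand a j p l v)%:E)%E.

Lemma layer_integralE n (a : 'I_n -> R) (j : 'I_n) p :
  (forall i, 0 < a i) ->
  layer_integral a j p = (p.+1%:R^-1%:E * radial_integral a j p.+1 p.+1)%E.
Proof.
move=> a0.
have mN := @measurable_sqnorm R n; have mA := @measurable_wsqnorm R n a.
rewrite /layer_integral ge0_tonelli; last 2 first.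
- exact: measurable_layer_integrand.
- exact: layer_integrand_ge0.
rewrite /radial_integral -ge0_integralZl_real; last 3 first.
- by rewrite invr_ge0.
- by mfun.
- by move=> v; exact: radial_integrand_ge0.
apply: eq_integral => v _.
have [vj0|vj0] := eqVneq (tnth v j) 0.
  rewrite integral0_eq; first by rewrite vj0 expr0n/= !(mul0r, mulr0).
  by move=> l _; rewrite /layer_integrand vj0 expr0n/= !(mul0r, mulr0).
have N0 := sqnorm_gt0 vj0.
have A0 := wsqnorm_gt0 (a0 j) vj0.
have sN0 : 0 < Num.sqrt (sqnorm v) by rewrite sqrtr_gt0.
have sA0 : 0 < Num.sqrt (wsqnorm a v) by rewrite sqrtr_gt0.
pose x := Num.sqrt (sqnorm v) / Num.sqrt (wsqnorm a v).
under eq_integral => l _.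
  rewrite (_ : layer_integrand _ _ _ _ _ = tnth v j ^+ 2 * expR (- sqnorm v) *
    (iverson ((0 < l) && (l < x)) * l ^+ p)); last first.
    rewrite /layer_integrand iversonM.
    have [l0|l0] := ltP 0 l; last by rewrite iversonF !(mul0r, mulr0).
    rewrite (_ : (_ * _ < _) = (l < x)); first by ring.
    rewrite ltr_pdivlMr// -{1}(sqr_sqrtr (ltW A0)) -{1}(sqr_sqrtr (ltW N0)) -exprMn.
    by rewrite ltr_pXn2r// nnegrE ?mulr_ge0// ltW.
  over.
rewrite ge0_integralZl_real; last 3 first.
- by rewrite mulr_ge0 ?sqr_ge0 ?expR_ge0.
- by mfun.
- move=> l; have [l0|l0] := ltP 0 l; last by rewrite iversonF mul0r.
  by rewrite mulr_ge0// exprn_ge0// ltW.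
rewrite integral_exprn; last by rewrite divr_ge0// ltW.
rewrite -EFinM; congr EFin; rewrite /x expr_div_n.
set y := _ ^+ p.+1; set z := (_ ^+ p.+1)^-1.
by ring.
Qed.

(** The quotient [|v| / |a v|] is bounded by the sum of the [1 / a_i]. *)
Lemma radial_integral_fin n (a : 'I_n -> R) (j : 'I_n) p :
  (forall i, 0 < a i) -> radial_integral a j p p \is a fin_num.
Proof.
move=> a0; rewrite ge0_fin_numE; last first.
  by apply: integral_ge0 => v _; rewrite lee_fin radial_integrand_ge0.
have mN := @measurable_sqnorm R n; have mA := @measurable_wsqnorm R n a.
pose M := \sum_(i < n) (a i)^-1.
have M0 : 0 <= M by apply: sumr_ge0 => i _; rewrite invr_ge0 ltW.
apply: (@le_lt_trans _ _ (\int[L n]_v (M ^+ p *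
    (tnth v j ^+ 2 * expR (- sqnorm v)))%:E)%E); last first.
  rewrite ge0_integralZl_real; last 3 first.
  - exact: exprn_ge0.
  - by mfun.
  - by move=> v; rewrite mulr_ge0 ?sqr_ge0 ?expR_ge0.
  by rewrite integral_sqr_gauss_tuple -EFinM ltry.
apply: ge0_le_integral => //.
- by move=> v _; rewrite lee_fin radial_integrand_ge0.
- by mfun.
- by mfun.
move=> v _; rewrite lee_fin.
have [vj0|vj0] := eqVneq (tnth v j) 0; first by rewrite vj0 expr0n/= !(mul0r, mulr0).
have A0 := wsqnorm_gt0 (a0 j) vj0.
have sA0 : 0 < Num.sqrt (wsqnorm a v) by rewrite sqrtr_gt0.
rewrite mulrA ler_pM2r ?expR_gt0// -mulrA [X in _ <= X]mulrC.
apply: ler_wpM2l; first exact: sqr_ge0.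
rewrite ler_pdivrMr ?exprn_gt0// -exprMn lerXn2r// ?nnegrE ?mulr_ge0 ?sqrtr_ge0//.
rewrite -(ler_pXn2r (n := 2))// ?nnegrE ?mulr_ge0 ?sqrtr_ge0//.
rewrite exprMn !sqr_sqrtr ?wsqnorm_ge0 ?sqnorm_ge0//.
rewrite /wsqnorm mulr_sumr; apply: ler_sum => i _.
rewrite mulrA -exprMn ler_peMl ?sqr_ge0// exprn_ege1//.
by rewrite -(mulVf (lt0r_neq0 (a0 i))) ler_pM2r// inv_le_sum_inv.
Qed.

(** Both evaluations of [radial_integral a j 0 p.+1 * gauss_moment p] are compared,
    and the Beta integral is eliminated with [gauss_momentM]. Finiteness of the
    radial integral carries over to [ellipsoid_integral], so that taking [fine]
    loses nothing. *)
Lemma radial_integral_closed n (a : 'I_n -> R) (j : 'I_n) p q :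
  (forall i, 0 < a i) -> (p + q = n)%N ->
  radial_integral a j p.+1 p.+1 =
  (gauss_momentR n.+1 / (gauss_momentR p * gauss_momentR q) *
    (Num.sqrt pi ^+ n / 2) * fine (ellipsoid_integral a j p))%:E.
Proof.
move=> a0 pqn.
have gp := @gauss_momentR_gt0 R p; have gq := @gauss_momentR_gt0 R q.
have gn := @gauss_momentR_gt0 R n.+1.
have E : (radial_integral a j p.+1 p.+1 * (gauss_moment p * gauss_moment q) =
    @gauss_moment R n.+1 * ((Num.sqrt pi ^+ n / 2)%:E * ellipsoid_integral a j p))%E.
  rewrite gauss_momentM pqn muleCA; congr (_ * _)%E.
  by rewrite -radial_integral_beta// radial_integral_gauss.
have := radial_integral_fin j p.+1 a0.
move: E; rewrite !gauss_momentE -!EFinM muleA -EFinM.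
case: (radial_integral _ _ _ _) => [x| |]// E _.
have c0 : 0 < gauss_momentR n.+1 * (Num.sqrt pi ^+ n / 2) :> R.
  by rewrite mulr_gt0// divr_gt0// exprn_gt0// sqrtr_gt0 pi_gt0.
case: (ellipsoid_integral a j p) E => [y| |].
- rewrite -!EFinM => -[E]; congr EFin.
  apply: (@mulIf _ (gauss_momentR p * gauss_momentR q)).
    by rewrite mulf_neq0// gt_eqF.
  by rewrite E /=; field; rewrite !gt_eqF.
- by rewrite gt0_muley.
- by rewrite gt0_muleNy.
Qed.

End layers.


(** * Rigid motions preserve volume *)

Section rigid.
Context {R : realType}.
Local Notation mR := (measurableTypeR R).
Local Notation mu := (@lebesgue_measure R).
Local Notation L := (@lebesgue_tuple R).

Definition row_of_tuple n (t : n.-tuple mR) : 'rV[R]_n := \row_i tnth t i.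

Definition tuple_of_row n (x : 'rV[R]_n) : n.-tuple mR := [tuple x 0 i | i < n].

Lemma row_of_tupleK n : cancel (@row_of_tuple n) (@tuple_of_row n).
Proof. by move=> t; apply: eq_from_tnth => i; rewrite tnth_mktuple mxE. Qed.

Lemma tuple_of_rowK n : cancel (@tuple_of_row n) (@row_of_tuple n).
Proof. by move=> x; apply/rowP => i; rewrite mxE tnth_mktuple. Qed.

Definition tuple_mul n (Q : 'M[R]_n) (t : n.-tuple mR) : n.-tuple mR :=
  [tuple \sum_(k < n) tnth t k * Q k i | i < n].

Definition tuple_add n (s t : n.-tuple mR) : n.-tuple mR :=
  [tuple tnth s i + tnth t i | i < n].

Lemma row_of_tuple_mul n (Q : 'M[R]_n) t :
  row_of_tuple (tuple_mul Q t) = row_of_tuple t *m Q.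
Proof.
apply/rowP => i; rewrite !mxE tnth_mktuple.
by apply: eq_bigr => k _; rewrite mxE.
Qed.

Lemma row_of_tuple_add n (s t : n.-tuple mR) :
  row_of_tuple (tuple_add s t) = row_of_tuple s + row_of_tuple t.
Proof. by apply/rowP => i; rewrite !mxE tnth_mktuple. Qed.

Lemma sqnorm_row n (t : n.-tuple mR) : sqnorm t = (row_of_tuple t *m (row_of_tuple t)^T) 0 0.
Proof. by rewrite mxE; apply: eq_bigr => i _; rewrite !mxE expr2. Qed.

Lemma sqnorm_mul n (Q : 'M[R]_n) t : Q *m Q^T = 1%:M ->
  sqnorm (tuple_mul Q t) = sqnorm t.
Proof.
move=> QQ; rewrite !sqnorm_row row_of_tuple_mul trmx_mul.
by rewrite mulmxA -(mulmxA _ Q) QQ mulmx1.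
Qed.

Lemma measurable_tuple_mul d (T : measurableType d) n (Q : 'M[R]_n) (f : T -> n.-tuple mR) :
  measurable_fun setT f -> measurable_fun setT (fun x => tuple_mul Q (f x)).
Proof.
move=> mf; apply/measurable_fun_tnthP => i.
rewrite (_ : _ \o _ = (fun x => \sum_(k < n) tnth (f x) k * Q k i)); first by mfun.
by apply/funext => x /=; rewrite tnth_mktuple.
Qed.

Lemma measurable_tuple_add d (T : measurableType d) n (f g : T -> n.-tuple mR) :
  measurable_fun setT f -> measurable_fun setT g ->
  measurable_fun setT (fun x => tuple_add (f x) (g x)).
Proof.
move=> mf mg; apply/measurable_fun_tnthP => i.
rewrite (_ : _ \o _ = (fun x => tnth (f x) i + tnth (g x) i)); first by mfun.
by apply/funext => x /=; rewrite tnth_mktuple.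
Qed.

Lemma integral_tuple_translate n (c : n.-tuple mR) (f : n.-tuple mR -> R) :
  measurable_fun setT f -> (forall x, 0 <= f x) ->
  (\int[L n]_v (f (tuple_add v c))%:E = \int[L n]_v (f v)%:E)%E.
Proof.
move=> mf f0.
rewrite -(@integral_tuple_affine _ _ (fun=> 1) (fun i => tnth c i) (fun v => (f v)%:E)); last 3 first.
- by move=> _; exact: oner_neq0.
- exact/measurable_EFinP.
- by move=> v; rewrite lee_fin.
rewrite big1 ?mul1e; last by move=> i _; rewrite normr1.
apply: eq_integral => v _; congr (f _)%:E.
by apply: eq_from_tnth => i; rewrite !tnth_mktuple mul1r.
Qed.

Lemma integral_tuple_reflect n (c : n.-tuple mR) (f : n.-tuple mR -> R) :
  measurable_fun setT f -> (forall x, 0 <= f x) ->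
  (\int[L n]_v (f (tuple_add c (tuple_mul (- 1%:M) v)))%:E = \int[L n]_v (f v)%:E)%E.
Proof.
move=> mf f0.
rewrite -(@integral_tuple_affine _ _ (fun=> -1) (fun i => tnth c i) (fun v => (f v)%:E)); last 3 first.
- by move=> _; rewrite oppr_eq0 oner_neq0.
- exact/measurable_EFinP.
- by move=> v; rewrite lee_fin.
rewrite big1 ?mul1e; last by move=> i _; rewrite normrN1.
apply: eq_integral => v _; congr (f _)%:E.
apply: eq_from_tnth => i; rewrite !tnth_mktuple addrC; congr (_ + _).
rewrite (bigD1 i)//= big1 ?addr0; last first.
  by move=> k ki; rewrite !mxE (negbTE ki) oppr0 mulr0.
by rewrite !mxE eqxx mulrC.
Qed.

(** A form of the uniqueness of Haar measure. With [g] the Gaussian weight, which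
    [Q] preserves, the product of [int f (Q x) dx] and [int g y dy] is rewritten by
    translations of [x] and [y] and exchanges of the integrals until it becomes
    the product of [int g x dx] and [int f y dy]. *)
Lemma integral_tuple_mul n (Q : 'M[R]_n) (f : n.-tuple mR -> R) :
  Q *m Q^T = 1%:M -> measurable_fun setT f -> (forall x, 0 <= f x) ->
  (\int[L n]_v (f (tuple_mul Q v))%:E = \int[L n]_v (f v)%:E)%E.
Proof.
move=> QQ mf f0.
have QtQ : Q^T *m Q = 1%:M by exact: mulmx1C.
pose g (v : n.-tuple mR) : R := expR (- sqnorm v).
have mg : measurable_fun setT g by have := @measurable_sqnorm R n; rewrite /g => ?; mfun.
have g0 v : 0 <= g v by exact: expR_ge0.
pose c : R := Num.sqrt pi ^+ n.
have c0 : 0 < c by rewrite exprn_gt0// sqrtr_gt0 pi_gt0.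
have gc : (\int[L n]_v (g v)%:E = c%:E)%E by exact: integral_gauss_tuple.
have mid d (T : measurableType d) : measurable_fun setT (fun x : T => x) by exact: measurable_id.
have mfM : measurable_fun setT (fun v => f (tuple_mul Q v)).
  by apply: (measurableT_comp mf); exact: measurable_tuple_mul.
have mgM : measurable_fun setT (fun v => g (tuple_mul Q v)).
  by apply: (measurableT_comp mg); exact: measurable_tuple_mul.
suff E : (c%:E * \int[L n]_v (f (tuple_mul Q v))%:E = c%:E * \int[L n]_v (f v)%:E)%E.
  have := congr1 (fun z => c^-1%:E * z)%E E.
  by rewrite !muleA -EFinM mulVf ?gt_eqF// !mul1e.
(* translate [y] by [Q x] *)
transitivity (\int[L n]_x \int[L n]_y (f (tuple_mul Q x) *
    g (tuple_add y (tuple_mul Q x)))%:E)%E.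
  rewrite muleC -ge0_integralZr//; last 3 first.
  - exact/measurable_EFinP.
  - by move=> x _; rewrite lee_fin.
  - by rewrite lee_fin ltW.
  apply: eq_integral => x _.
  rewrite ge0_integralZl_real//; first by rewrite integral_tuple_translate// gc.
  apply: (measurableT_comp mg); apply: measurable_tuple_add => //.
have m1 : measurable_fun setT (fun z : n.-tuple mR * n.-tuple mR =>
    f (tuple_mul Q z.1) * g (tuple_add z.2 (tuple_mul Q z.1))).
  mfun_step.
    by apply: (measurableT_comp mf); apply: measurable_tuple_mul; exact: measurable_fst.
  apply: (measurableT_comp mg); apply: measurable_tuple_add; first exact: measurable_snd.
  by apply: measurable_tuple_mul; exact: measurable_fst.
rewrite ge0_tonelli//; last by move=> x y; rewrite mulr_ge0.
pose sh (y : n.-tuple mR) := tuple_mul (- 1%:M) y.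
(* translate [x] by the inverse image of [- y] *)
transitivity (\int[L n]_y \int[L n]_x (f (tuple_add (tuple_mul Q x) (sh y)) *
    g (tuple_mul Q x))%:E)%E.
  apply: eq_integral => y _.
  rewrite -(@integral_tuple_translate _ (tuple_mul (- Q^T) y) (fun x => f (tuple_mul Q x) *
    g (tuple_add y (tuple_mul Q x)))); last 2 first.
  - mfun_step => //; apply: (measurableT_comp mg); apply: measurable_tuple_add.
      exact: measurable_cst.
    exact: measurable_tuple_mul.
  - by move=> x; rewrite mulr_ge0.
  apply: eq_integral => x _; congr (f _ * g _)%:E; apply: (can_inj (@row_of_tupleK n)).
    rewrite !(row_of_tuple_mul, row_of_tuple_add) mulmxDl; congr (_ + _).
    by rewrite -mulmxA mulNmx QtQ.
  rewrite !(row_of_tuple_mul, row_of_tuple_add) mulmxDl addrCA.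
  by rewrite -mulmxA mulNmx QtQ mulmxN mulmx1 addrN addr0.
have msh : measurable_fun setT sh by exact: measurable_tuple_mul.
have m2 : measurable_fun setT (fun z : n.-tuple mR * n.-tuple mR =>
    f (tuple_add (tuple_mul Q z.2) (sh z.1)) * g (tuple_mul Q z.2)).
  mfun_step.
    apply: (measurableT_comp mf); apply: measurable_tuple_add.
      by apply: measurable_tuple_mul; exact: measurable_snd.
    by apply: measurable_tuple_mul; exact: measurable_fst.
  by apply: (measurableT_comp mg); apply: measurable_tuple_mul; exact: measurable_snd.
rewrite ge0_tonelli//; last by move=> x y; rewrite mulr_ge0.
rewrite -gc -ge0_integralZr//; last 3 first.
- exact/measurable_EFinP.
- by move=> x _; rewrite lee_fin.
- by apply: integral_ge0 => v _; rewrite lee_fin.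
apply: eq_integral => x _.
under eq_integral do rewrite mulrC.
rewrite ge0_integralZl_real//.
  by rewrite integral_tuple_reflect// {1}/g sqnorm_mul.
apply: (measurableT_comp mf); exact: measurable_tuple_add.
Qed.

Lemma lebesgue_tupleE n (A : set (n.-tuple mR)) : measurable A ->
  L n A = (\int[L n]_v (\1_A v : R)%:E)%E.
Proof. by move=> mA; rewrite integral_indic// setIT. Qed.

Lemma lebesgue_tuple_rigid n (Q : 'M[R]_n) (c : n.-tuple mR) (A : set (n.-tuple mR)) :
  Q *m Q^T = 1%:M -> measurable A ->
  L n [set t | A (tuple_mul Q (tuple_add t c))] = L n A.
Proof.
move=> QQ mA.
have mi : measurable_fun setT (\1_A : n.-tuple mR -> R) by exact: measurable_indic.
have i0 v : 0 <= (\1_A v : R) by [].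
have mh : measurable_fun setT (fun t => tuple_mul Q (tuple_add t c)).
  apply: measurable_tuple_mul; apply: measurable_tuple_add; first exact: measurable_id.
  exact: measurable_cst.
have mB : measurable [set t | A (tuple_mul Q (tuple_add t c))].
  by rewrite -[X in measurable X]setTI; exact: mh.
rewrite (lebesgue_tupleE mB) (lebesgue_tupleE mA) -(integral_tuple_mul QQ mi i0).
rewrite -[RHS](@integral_tuple_translate _ c (fun v => \1_A (tuple_mul Q v))) => [//||//].
apply: (measurableT_comp mi); apply: measurable_tuple_mul; exact: measurable_id.
Qed.

Lemma volume_rigid n (f : 'rV[R]_n -> 'rV[R]_n) (S : set 'rV[R]_n) :
  rigid_motion f -> measurable [set t : n.-tuple mR | S (row_of_tuple t)] ->
  volume (f @` S) = L n [set t | S (row_of_tuple t)].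
Proof.
move=> [Q [c [QQ fE]]] mS.
have QtQ : Q^T *m Q = 1%:M by exact: mulmx1C.
rewrite -(@lebesgue_tuple_rigid _ Q^T (tuple_of_row (- c)) _ _ mS) ?trmxK//.
rewrite /volume; congr (L n _); apply/seteqP; split => t /=.
  move=> [x Sx]; rewrite fE -/(row_of_tuple t) => xt.
  rewrite row_of_tuple_mul row_of_tuple_add tuple_of_rowK -xt addrK.
  by rewrite -mulmxA QQ mulmx1.
rewrite -/(row_of_tuple t) => h; eexists; first exact: h.
rewrite fE row_of_tuple_mul row_of_tuple_add tuple_of_rowK.
by rewrite -mulmxA QtQ mulmx1 subrK.
Qed.

End rigid.


(** * Parallel bodies and their layers *)

Section parallel_body.
Context {R : realType}.
Local Notation mR := (measurableTypeR R).
Local Notation mu := (@lebesgue_measure R).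
Local Notation L := (@lebesgue_tuple R).
Variables (n : nat) (a : 'I_n -> R) (a0 : forall i, 0 < a i).

Definition std_ellipsoid : set 'rV[R]_n :=
  [set x : 'rV[R]_n | \sum_(i < n) x 0 i ^+ 2 / a i ^+ 2 <= 1].

Definition parallel_body (r : R) : set 'rV[R]_n :=
  minkowski_sum std_ellipsoid (dilate r (@unit_ball R n)).

(** With [v_i = x_i / (r + l a_i^2)], [layer_sq] is [|v|^2], [layer_sqD] is the
    opposite of its derivative in [l], and [layer_gap] is [|v|^2 - l^2 |a v|^2]. *)
Definition layer_sq (r l : R) (x : n.-tuple mR) : R :=
  \sum_(i < n) tnth x i ^+ 2 / (r + l * a i ^+ 2) ^+ 2.

Definition layer_sqD (r l : R) (x : n.-tuple mR) : R :=
  \sum_(i < n) 2 * a i ^+ 2 * (tnth x i ^+ 2 / (r + l * a i ^+ 2) ^+ 3).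

Definition layer_gap (r l : R) (x : n.-tuple mR) : R :=
  \sum_(i < n) tnth x i ^+ 2 * ((1 - l ^+ 2 * a i ^+ 2) / (r + l * a i ^+ 2) ^+ 2).

(** If [|v| <= 1] then [x = l a^2 v + r v] is a decomposition in [E + r B], because
    [l |a v| = |v|]. Conversely let [x = y + r z] with [y] in [E] and [z] in [B], and
    pair with [v]: [<v, x> = r |v|^2 + l |a v|^2], whereas [<v, y>] and [<v, z>] are
    bounded by the arithmetic-geometric mean inequality. With [N = |v|^2] this
    becomes [(1 + l r) (N - 1) <= 0]. *)
Lemma mem_parallel_body (r l : R) (x : n.-tuple mR) : 0 < r -> 0 <= l ->
  layer_gap r l x = 0 ->
  parallel_body r (row_of_tuple x) <-> layer_sq r l x <= 1.
Proof.
move=> r0 l0 gap0.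
have d0 i : 0 < r + l * a i ^+ 2 by rewrite ltr_pwDl// mulr_ge0 ?sqr_ge0.
pose v i := tnth x i / (r + l * a i ^+ 2).
have xE i : tnth x i = r * v i + l * a i ^+ 2 * v i.
  by rewrite -mulrDl /v mulrC divfK// gt_eqF.
have qE : layer_sq r l x = \sum_(i < n) v i ^+ 2.
  by apply: eq_bigr => i _; rewrite expr_div_n.
have vE : l ^+ 2 * \sum_(i < n) a i ^+ 2 * v i ^+ 2 = \sum_(i < n) v i ^+ 2.
  apply/esym/eqP; rewrite -subr_eq0 -[X in _ == X]gap0 mulr_sumr -sumrB.
  by apply/eqP/eq_bigr => i _; rewrite /v expr_div_n; field; rewrite gt_eqF.
rewrite qE; split => [[y yE [_ [z zB <-] xyz]]|v1].
- have xyzi i : tnth x i = y 0 i + r * z 0 i.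
    by have /rowP/(_ i) := xyz; rewrite !mxE.
  have z1 : \sum_(i < n) z 0 i ^+ 2 <= 1.
    by move: zB; rewrite /unit_ball/= /enorm -{1}sqrtr1 ler_psqrt// nnegrE// sumr_ge0// => i _; exact: sqr_ge0.
  have S1 : \sum_(i < n) v i * tnth x i =
      r * \sum_(i < n) v i ^+ 2 + l * \sum_(i < n) a i ^+ 2 * v i ^+ 2.
    rewrite !mulr_sumr -big_split/=; apply: eq_bigr => i _; rewrite xE; ring.
  have S2 : l * \sum_(i < n) v i * tnth x i <=
      (\sum_(i < n) y 0 i ^+ 2 / a i ^+ 2 + l ^+ 2 * \sum_(i < n) a i ^+ 2 * v i ^+ 2) / 2
      + l * r * ((\sum_(i < n) v i ^+ 2 + \sum_(i < n) z 0 i ^+ 2) / 2).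
    rewrite !mulr_sumr -!big_split/= !mulr_suml mulr_sumr -big_split/=.
    apply: ler_sum => i _; rewrite xyzi.
    have := sqr_ge0 (y 0 i / a i - l * (a i * v i)).
    have -> : (y 0 i / a i - l * (a i * v i)) ^+ 2 = y 0 i ^+ 2 / a i ^+ 2
       + l ^+ 2 * (a i ^+ 2 * v i ^+ 2) - 2 * l * (v i * y 0 i).
      by field; rewrite gt_eqF.
    have := mulr_ge0 (mulr_ge0 l0 (ltW r0)) (sqr_ge0 (v i - z 0 i)).
    set A := y 0 i ^+ 2 / _; set B := l ^+ 2 * _.
    by move=> h1 h2; lra.
  rewrite S1 in S2; rewrite vE in S2; move: S2 vE.
  set N := \sum_(i < n) v i ^+ 2; set W := \sum_(i < n) _ * _.
  move=> S2 vE; rewrite /std_ellipsoid/= in yE.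
  have lr : 0 <= l * r by rewrite mulr_ge0// ltW.
  have h3 : l * (r * N + l * W) = l * r * N + N by rewrite -vE; ring.
  rewrite h3 in S2.
  have h4 : l * r * ((N + \sum_(i < n) z 0 i ^+ 2) / 2) <= l * r * ((N + 1) / 2).
    by apply: ler_wpM2l => //; rewrite ler_pM2r// lerD2l.
  have h5 : (1 + l * r) * (N - 1) <= 0.
    by rewrite (_ : _ * _ = 2 * ((l * r * N + N) - ((1 + N) / 2 + l * r * ((N + 1) / 2)))); [lra|field].
  by move: h5; rewrite pmulr_rle0 ?subr_le0// ltr_pwDl.
- exists (\row_i (l * a i ^+ 2 * v i)).
    rewrite /std_ellipsoid/= (_ : (\sum_(i < n) _) = l ^+ 2 * \sum_(i < n) a i ^+ 2 * v i ^+ 2).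
      by rewrite vE.
    by rewrite mulr_sumr; apply: eq_bigr => i _; rewrite mxE; field; rewrite gt_eqF.
  exists (r *: \row_i v i).
    exists (\row_i v i) => //; rewrite /unit_ball/= /enorm.
    under eq_bigr do rewrite mxE.
    by rewrite -[X in _ <= X]sqrtr1 ler_wsqrtr.
  by apply/rowP => i; rewrite !mxE xE addrC.
Qed.

Lemma layer_sq_scale r l (c : R) (x : n.-tuple mR) :
  layer_sq r l (tuple_affine (fun _ => c) (fun _ => 0) x) = c ^+ 2 * layer_sq r l x.
Proof.
rewrite /layer_sq mulr_sumr; apply: eq_bigr => i _.
by rewrite tnth_mktuple addr0 exprMn mulrA.
Qed.

Lemma layer_gap_scale r l (c : R) (x : n.-tuple mR) :
  layer_gap r l (tuple_affine (fun _ => c) (fun _ => 0) x) = c ^+ 2 * layer_gap r l x.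
Proof.
rewrite /layer_gap mulr_sumr; apply: eq_bigr => i _.
by rewrite tnth_mktuple addr0 exprMn mulrA.
Qed.

Lemma mem_dilated_parallel_body (r l rho : R) (x : n.-tuple mR) :
  0 < r -> 0 <= l -> 0 < rho -> layer_gap r l x = 0 ->
  parallel_body r (row_of_tuple (tuple_affine (fun _ => rho^-1) (fun _ => 0) x)) <->
  layer_sq r l x <= rho ^+ 2.
Proof.
move=> r0 l0 rho0 gap0; rewrite (mem_parallel_body r0 l0); last first.
  by rewrite layer_gap_scale gap0 mulr0.
by rewrite layer_sq_scale exprVn mulrC ler_pdivrMr ?exprn_gt0// mul1r.
Qed.

Lemma layer_gap_term_decr (r b l1 l2 : R) : 0 < r -> 0 < b -> 0 <= l1 -> l1 < l2 ->
  (1 - l2 ^+ 2 * b ^+ 2) / (r + l2 * b ^+ 2) ^+ 2 <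
  (1 - l1 ^+ 2 * b ^+ 2) / (r + l1 * b ^+ 2) ^+ 2.
Proof.
move=> r0 b0 l10 l12.
have l20 : 0 <= l2 by rewrite ltW// (le_lt_trans l10).
have bb : 0 < b ^+ 2 by rewrite exprn_gt0.
have d1 : 0 < r + l1 * b ^+ 2 by rewrite ltr_pwDl// mulr_ge0// ltW.
have d2 : 0 < r + l2 * b ^+ 2 by rewrite ltr_pwDl// mulr_ge0// ltW.
rewrite ltr_pdivrMr ?exprn_gt0// [ltRHS]mulrAC ltr_pdivlMr ?exprn_gt0// -subr_gt0.
rewrite (_ : _ - _ = ((r + l2 * b ^+ 2) ^+ 2 - (r + l1 * b ^+ 2) ^+ 2) + b ^+ 2 *
   ((l2 * (r + l1 * b ^+ 2)) ^+ 2 - (l1 * (r + l2 * b ^+ 2)) ^+ 2)); last by ring.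
apply: ltr_pwDl.
  by rewrite subr_gt0 ltr_pXn2r ?nnegrE ?(ltW d1) ?(ltW d2)// ltrD2l ltr_pM2r.
apply: mulr_ge0; first exact: ltW.
rewrite subr_ge0 lerXn2r ?nnegrE ?mulr_ge0 ?(ltW d1) ?(ltW d2)//.
rewrite -subr_ge0 (_ : _ - _ = r * (l2 - l1)); last by ring.
by rewrite mulr_ge0 ?subr_ge0 ?ltW.
Qed.

Lemma layer_gap_decr (r l1 l2 : R) (j : 'I_n) (x : n.-tuple mR) :
  0 < r -> tnth x j != 0 -> 0 <= l1 -> l1 < l2 ->
  layer_gap r l2 x < layer_gap r l1 x.
Proof.
move=> r0 xj l10 l12; rewrite /layer_gap (bigD1 j)//= [ltRHS](bigD1 j)//=.
apply: ltr_leD.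
  by rewrite ltr_pM2l ?layer_gap_term_decr// exprn_even_gt0.
apply: ler_sum => i _; apply: ler_wpM2l; first exact: sqr_ge0.
by rewrite ltW// layer_gap_term_decr.
Qed.

Lemma is_derive_layer_sq (r l : R) (x : n.-tuple mR) : 0 < r -> 0 <= l ->
  is_derive l (1 : R) (fun l => layer_sq r l x) (- layer_sqD r l x).
Proof.
move=> r0 l0.
have d0 i : r + l * a i ^+ 2 != 0 by rewrite gt_eqF// ltr_pwDl// mulr_ge0 ?sqr_ge0.
rewrite /layer_sqD -sumrN; apply: is_derive_bigsum => i.
apply: is_derive_eq.
  apply: is_deriveMl; apply: (@is_deriveVn _ (fun l => (r + l * a i ^+ 2) ^+ 2)).
    by rewrite expf_neq0.
by rewrite /GRing.scale/=; field.
Qed.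

Lemma derivable_continuous_at (f : R -> R) (l : R) :
  derivable f l 1 -> {for l, continuous f}.
Proof. by move=> df; apply: differentiable_continuous; exact/derivable1_diffP. Qed.

Lemma continuous_bigsum (h : 'I_n -> R -> R) (l : R) :
  (forall i, {for l, continuous (h i)}) ->
  {for l, continuous (fun t => \sum_(i < n) h i t)}.
Proof.
move=> ch; suff sum_cvg (s : seq 'I_n) :
  (\sum_(i <- s) h i t) @[t --> l] --> \sum_(i <- s) h i l by exact: sum_cvg.
elim: s => [|i s IH].
  by under eq_fun do rewrite big_nil; rewrite big_nil; exact: cvg_cst.
under eq_fun do rewrite big_cons; rewrite big_cons.
by apply: cvgD; [exact: ch|exact: IH].
Qed.

Lemma continuous_layer_den (r l : R) (i : 'I_n) (k : nat) : 0 < r -> 0 <= l ->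
  {for l, continuous (fun l : R => ((r + l * a i ^+ 2) ^+ k)^-1)}.
Proof.
move=> r0 l0.
apply: (@cvgV _ _ _ _ (fun l => (r + l * a i ^+ 2) ^+ k)).
  by rewrite expf_neq0// gt_eqF// ltr_pwDl// mulr_ge0 ?sqr_ge0.
apply: (@cvg_comp _ _ _ (fun t : R => r + t * a i ^+ 2) (fun x : R => x ^+ k) _
  (nbhs (r + l * a i ^+ 2))); last exact: exprn_continuous.
by apply: cvgD; [exact: cvg_cst|apply: cvgM; [exact: cvg_id|exact: cvg_cst]].
Qed.

Lemma layer_sqD_continuous (r l : R) (x : n.-tuple mR) : 0 < r -> 0 <= l ->
  {for l, continuous (fun l => layer_sqD r l x)}.
Proof.
move=> r0 l0; apply: continuous_bigsum => i.
apply: cvgM; first exact: cvg_cst.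
by apply: cvgM; [exact: cvg_cst|exact: continuous_layer_den].
Qed.

Lemma layer_gap_continuous (r l : R) (x : n.-tuple mR) : 0 < r -> 0 <= l ->
  {for l, continuous (fun l => layer_gap r l x)}.
Proof.
move=> r0 l0; apply: continuous_bigsum => i.
apply: cvgM; first exact: cvg_cst.
apply: cvgM; last exact: continuous_layer_den.
apply: cvgB; first exact: cvg_cst.
by apply: cvgM; [exact: exprn_continuous|exact: cvg_cst].
Qed.

(** The gap is nonnegative at [l = 0] and nonpositive as soon as [l a_i >= 1] for
    all [i]. *)
Lemma layer_gap_root (r : R) (x : n.-tuple mR) : 0 < r ->
  exists2 l, 0 <= l & layer_gap r l x = 0.
Proof.
move=> r0.
pose M := \sum_(i < n) (a i)^-1.
have M0 : 0 <= M by apply: sumr_ge0 => i _; rewrite invr_ge0 ltW.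
have [l lM gl] : exists2 l, l \in `[0, M] & layer_gap r l x = 0; last first.
  by exists l => //; move: lM; rewrite in_itv/= => /andP[].
apply: (@IVT _ (fun l => layer_gap r l x) 0 M 0) => //.
  apply: continuous_in_subspaceT => l; rewrite inE/= in_itv/= => /andP[l0 _].
  exact: layer_gap_continuous.
have g0 : 0 <= layer_gap r 0 x.
  apply: sumr_ge0 => i _; rewrite mulr_ge0 ?sqr_ge0//.
  by rewrite expr0n/= mul0r subr0 addr0 divr_ge0 ?sqr_ge0.
have gM : layer_gap r M x <= 0.
  apply: sumr_le0 => i _; apply: mulr_ge0_le0; first exact: sqr_ge0.
  apply: mulr_le0_ge0; last by rewrite invr_ge0 sqr_ge0.
  rewrite subr_le0 -exprMn exprn_ege1//.
  by rewrite -(mulVf (lt0r_neq0 (a0 i))) ler_pM2r// inv_le_sum_inv.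
by rewrite ge_min le_max gM g0 orbT.
Qed.

Definition layer_density (r l : R) (x : n.-tuple mR) : R :=
  iverson (0 < l) * (iverson (0 < layer_gap r l x) *
    (layer_sqD r l x * expR (- layer_sq r l x))).

Lemma layer_density_ge0 r l x : 0 < r -> 0 <= layer_density r l x.
Proof.
move=> r0; rewrite /layer_density.
have [l0|l0] := ltP 0 l; last by rewrite iversonF mul0r.
rewrite mul1r mulr_ge0// mulr_ge0 ?expR_ge0//.
apply: sumr_ge0 => i _; apply: mulr_ge0; first by rewrite mulr_ge0 ?sqr_ge0.
apply: divr_ge0; first exact: sqr_ge0.
by apply/exprn_ge0/addr_ge0; [exact: ltW|rewrite mulr_ge0 ?sqr_ge0// ltW].
Qed.

(** For [x <> 0] the gap is strictly decreasing, so that the bracket on the gap cuts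
    out the interval from [0] to its root; for [x = 0] the density vanishes. *)
Lemma integral_layer_density (r l : R) (x : n.-tuple mR) : 0 < r -> 0 <= l ->
  layer_gap r l x = 0 ->
  (\int[mu]_l (layer_density r l x)%:E =
   (expR (- layer_sq r l x) - expR (- layer_sq r 0 x))%:E)%E.
Proof.
move=> r0 l0 gap0.
have dF t : 0 <= t <= l -> is_derive t (1 : R) (fun t => expR (- layer_sq r t x))
    (layer_sqD r t x * expR (- layer_sq r t x)).
  move=> /andP[t0 _]; apply: is_derive_exp.
  by rewrite -[X in is_derive _ _ _ X]opprK; apply: is_deriveN; exact: is_derive_layer_sq.
rewrite -(FTC_segment l0 dF); last first.
  move=> t tl; have /andP[t0 _] := tl; apply: cvgM; first exact: layer_sqD_continuous.
  apply: (@derivable_continuous_at (fun t => expR (- layer_sq r t x))).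
  by case: (dF t tl).
apply: eq_integral => t _; congr EFin.
rewrite /layer_density iversonM -mulrA; have [t0|t0] := ltP 0 t; last by rewrite iversonF !mul0r.
have [/forallP x0|] := boolP [forall i, tnth x i == 0].
  rewrite (_ : layer_sqD _ _ _ = 0) ?(mul0r, mulr0)// /layer_sqD big1// => i _.
  by rewrite (eqP (x0 i)) expr0n/= mul0r mulr0.
rewrite negb_forall => /existsP[j xj]; congr (_ * (iverson _ * _)).
rewrite -gap0; have [tl|lt|->] := ltgtP t l; last by rewrite ltxx.
- exact: (layer_gap_decr r0 xj (ltW t0) tl).
- by apply/negbTE; rewrite -leNgt ltW// (layer_gap_decr r0 xj l0 lt).
Qed.

(** [exp (- g^2)] for the gauge [g] of [parallel_body r], in a form in which its
    measurability and its integral are accessible. *)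
Definition gauge_gauss (r : R) (x : n.-tuple mR) : \bar R :=
  ((expR (- layer_sq r 0 x))%:E + \int[mu]_l (layer_density r l x)%:E)%E.

Lemma gauge_gaussE (r : R) (x : n.-tuple mR) : 0 < r ->
  exists l, [/\ 0 <= l, layer_gap r l x = 0 &
    gauge_gauss r x = (expR (- layer_sq r l x))%:E].
Proof.
move=> r0; have [l l0 gap0] := layer_gap_root x r0; exists l; split => //.
by rewrite /gauge_gauss (integral_layer_density r0 l0 gap0) -EFinD addrC subrK.
Qed.

Lemma measurable_layer_density r :
  measurable_fun [set: mR * n.-tuple mR] (fun z => layer_density r z.1 z.2).
Proof. by rewrite /layer_density /layer_gap /layer_sq /layer_sqD; mfun. Qed.

Lemma measurable_gauge_gauss (r : R) : 0 < r -> measurable_fun setT (gauge_gauss r).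
Proof.
move=> r0; apply: emeasurable_funD.
  by rewrite /layer_sq; mfun.
apply: (@measurable_fun_fubini_tonelli_G _ _ _ _ _ mu (fun z => (layer_density r z.1 z.2)%:E)).
  by apply/measurable_EFinP; exact: measurable_layer_density.
by move=> z; rewrite lee_fin layer_density_ge0.
Qed.

End parallel_body.


(** * Volume of the parallel bodies *)

Section gauge_integral.
Context {R : realType}.
Local Notation mR := (measurableTypeR R).
Local Notation mu := (@lebesgue_measure R).
Local Notation L := (@lebesgue_tuple R).

(** Expanding the product chooses a set of factors, and these sets are sorted by
    cardinality. *)
Lemma prod_elem_sym N (t : 'I_N -> R) (r l : R) :
  \prod_(i < N) (r + l * t i) =
  \sum_(m < N.+1) elem_sym m t * l ^+ m * r ^+ (N - m).
Proof.
under eq_bigr do rewrite addrC.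
rewrite bigA_distr (partition_big (fun A : {set 'I_N} => inord #|A| : 'I_N.+1) predT)//=.
apply: eq_bigr => m _; rewrite /elem_sym !mulr_suml.
apply: eq_big => [A|A /eqP Am].
  have A_le : (#|A| < N.+1)%N by rewrite ltnS -[X in (_ <= X)%N]card_ord max_card.
  apply/eqP/eqP => [<-|Am]; first by rewrite inordK.
  by apply: val_inj; rewrite /= inordK.
have {}Am : #|A| = m.
  by rewrite -Am inordK// ltnS -[X in (_ <= X)%N]card_ord max_card.
rewrite (bigID (mem A))/=; congr (_ * _).
  rewrite (eq_bigr (fun i => l * t i)); last by move=> i ->.
  by rewrite big_split/= prodr_const Am mulrC.
rewrite (eq_bigr (fun=> r)); last by move=> i /negbTE ->.
rewrite prodr_const -[X in (X - _)%N]card_ord -Am; congr (_ ^+ _).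
by rewrite -(cardC A) addKn; apply: eq_card => i; rewrite !inE.
Qed.

Section fixed_axes.
Variables (n : nat) (a : 'I_n -> R) (a0 : forall i, 0 < a i).

Lemma fine_gauge_gauss r x : 0 < r -> gauge_gauss a r x = (fine (gauge_gauss a r x))%:E.
Proof. by move=> r0; have [l [_ _ ->]] := gauge_gaussE a0 x r0. Qed.

Lemma parallel_body_gauge (r c : R) (x : n.-tuple mR) : 0 < r -> 0 < c ->
  parallel_body a r (row_of_tuple
    (tuple_affine (fun _ => (Num.sqrt c)^-1) (fun _ => 0) x)) <->
  expR (- c) <= fine (gauge_gauss a r x).
Proof.
move=> r0 c0; have [l [l0 gap0 ->]] := gauge_gaussE a0 x r0.
rewrite (mem_dilated_parallel_body a0 r0 l0 _ gap0) ?sqrtr_gt0//.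
by rewrite (sqr_sqrtr (ltW c0)) /= ler_expR lerN2.
Qed.

Lemma measurable_parallel_body (r : R) : 0 < r ->
  measurable [set t : n.-tuple mR | parallel_body a r (row_of_tuple t)].
Proof.
move=> r0.
rewrite (_ : [set t | _] = setT `&` [set t | ((expR (- 1))%:E <= gauge_gauss a r t)%E]).
  by apply: emeasurable_fun_c_infty => //; exact: measurable_gauge_gauss.
apply/seteqP; split => t /=.
  move=> h; split => //; rewrite (fine_gauge_gauss t r0) lee_fin.
  apply/(parallel_body_gauge t r0 ltr01); rewrite sqrtr1 invr1.
  rewrite (_ : tuple_affine _ _ _ = t)//; apply: eq_from_tnth => i.
  by rewrite tnth_mktuple mul1r addr0.
move=> [_]; rewrite (fine_gauge_gauss t r0) lee_fin.
move=> /(parallel_body_gauge t r0 ltr01); rewrite sqrtr1 invr1.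
rewrite (_ : tuple_affine _ _ _ = t)//; apply: eq_from_tnth => i.
by rewrite tnth_mktuple mul1r addr0.
Qed.

Lemma measurable_fine_gauge_gauss (r : R) : 0 < r ->
  measurable_fun setT (fun x => fine (gauge_gauss a r x)).
Proof.
move=> r0; apply: (measurableT_comp (f := @fine R)).
  exact: fine_measurable.
exact: measurable_gauge_gauss.
Qed.

Lemma lebesgue_tuple_dilate (c : R) (A : set (n.-tuple mR)) : 0 < c -> measurable A ->
  L n [set x | A (tuple_affine (fun _ => c^-1) (fun _ => 0) x)] = ((c ^+ n)%:E * L n A)%E.
Proof.
move=> c0 mA.
have mi : measurable_fun setT (\1_A : n.-tuple mR -> R) by exact: measurable_indic.
have mB : measurable [set x | A (tuple_affine (fun _ => c^-1) (fun _ => 0) x)].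
  by rewrite -[X in measurable X]setTI; exact: measurable_tuple_affine.
rewrite (lebesgue_tupleE mB) (lebesgue_tupleE mA).
rewrite (@integral_tuple_scale _ _ c^-1 (fun v => (\1_A v : R)%:E)) ?invr_gt0//.
- by rewrite exprVn invrK.
- exact/measurable_EFinP.
Qed.

(** Layer cake: the set where [exp (- c) <= gauge_gauss a r x] is the body dilated
    by [sqrt c], whose volume is proportional to [sqrt c ^ n]. *)
Lemma volume_gauge (r : R) : 0 < r ->
  ((2 * gauss_momentR n.+1)%:E *
    L n [set t : n.-tuple mR | parallel_body a r (row_of_tuple t)] =
   \int[L n]_x gauge_gauss a r x)%E.
Proof.
move=> r0.
have mg := measurable_fine_gauge_gauss r0.
have mK := measurable_parallel_body r0.
transitivity (\int[L n]_x \int[mu]_c (iverson (0 < c) * expR (- c) *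
    iverson (expR (- c) <= fine (gauge_gauss a r x)))%:E)%E; last first.
  apply: eq_integral => x _; rewrite (fine_gauge_gauss x r0).
  have [l [l0 gap0 ->]] := gauge_gaussE a0 x r0.
  rewrite /= -integral_expRN_ge; last first.
    by apply: sumr_ge0 => i _; rewrite divr_ge0 ?sqr_ge0.
  by apply: eq_integral => c _; rewrite ler_expR lerN2.
rewrite ge0_tonelli; last 2 first.
- mfun; exact: (measurableT_comp mg measurable_fst).
- by move=> x c; rewrite !mulr_ge0// expR_ge0.
rewrite -integral_sqrt_expR -ge0_integralZr//; last 2 first.
- by mfun.
- move=> c _; rewrite lee_fin; exact: mulr_ge0.
apply: eq_integral => c _.
rewrite ge0_integralZl_real; last 3 first.
- by rewrite mulr_ge0// expR_ge0.
- by mfun.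
- by [].
have [c0|c0] := ltP 0 c; last by rewrite iversonF !mul0r !mul0e.
rewrite mulrCA mul1r [X in X%:E]mulrC.
rewrite (_ : (\int[L n]_x _)%E = ((Num.sqrt c ^+ n)%:E *
   L n [set t : n.-tuple mR | parallel_body a r (row_of_tuple t)])%E).
  by rewrite muleA -EFinM; congr (_%:E * _)%E; ring.
rewrite -(@lebesgue_tuple_dilate _ [set t | _]) ?sqrtr_gt0//.
rewrite lebesgue_tupleE; last first.
  by rewrite -[X in measurable X]setTI; exact: measurable_tuple_affine.
apply: eq_integral => x _; rewrite indicE /iverson; congr (_%:R)%:E.
congr nat_of_bool; apply/idP/idP.
- by move=> /(parallel_body_gauge x r0 c0) h; rewrite inE.
- by rewrite inE => /(parallel_body_gauge x r0 c0).
Qed.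

End fixed_axes.
End gauge_integral.


Section steiner_sum.
Context {R : realType}.
Local Notation mR := (measurableTypeR R).
Local Notation mu := (@lebesgue_measure R).
Local Notation L := (@lebesgue_tuple R).
Variables (n : nat) (a : 'I_n -> R) (a0 : forall i, 0 < a i).

Definition minor_sym (j : 'I_n) (m : nat) : R :=
  elem_sym m (fun i : 'I_n.-1 => a (lift j i) ^+ 2).

Lemma minor_sym_ge0 j m : 0 <= minor_sym j m.
Proof. by apply: sumr_ge0 => A _; apply: prodr_ge0 => i _; exact: sqr_ge0. Qed.

Lemma prod_layer_den (r l : R) (j : 'I_n) :
  \prod_(i < n) (r + l * a i ^+ 2) = (r + l * a j ^+ 2) *
    \sum_(m < n) minor_sym j m * l ^+ m * r ^+ (n.-1 - m).
Proof.
rewrite (bigD1_ord j)//= prod_elem_sym; congr (_ * _).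
by rewrite prednK ?(leq_ltn_trans _ (ltn_ord j)).
Qed.

Definition layer_weight (r : R) (j : 'I_n) (m : 'I_n) : R :=
  2 * a j ^+ 2 * minor_sym j m * r ^+ (n.-1 - m).

Lemma layer_weight_ge0 r j m : 0 <= r -> 0 <= layer_weight r j m.
Proof.
move=> r0; apply: mulr_ge0; last exact: exprn_ge0.
by rewrite mulr_ge0 ?minor_sym_ge0// mulr_ge0 ?sqr_ge0.
Qed.

(** In the coordinates [v], [r] survives only in the Jacobian and in the
    denominators of [layer_sqD]. The factor of index [j] of the Jacobian cancels
    the denominator of the [j]-th summand, and the other factors expand in
    elementary symmetric functions. *)
Lemma layer_density_affine (r l : R) (v : n.-tuple mR) : 0 < r -> 0 < l ->
  (\prod_(i < n) (r + l * a i ^+ 2)) *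
    layer_density a r l (tuple_affine (fun i => r + l * a i ^+ 2) (fun _ => 0) v) =
  \sum_(j < n) \sum_(m < n) layer_weight r j m * layer_integrand a j m l v.
Proof.
move=> r0 l0.
have d0 i : r + l * a i ^+ 2 != 0 by rewrite gt_eqF// ltr_pwDl// mulr_ge0 ?sqr_ge0// ltW.
rewrite /layer_density.
rewrite (_ : layer_sq _ _ _ _ = sqnorm v); last first.
  apply: eq_bigr => i _; rewrite tnth_mktuple addr0 exprMn mulrAC mulfV ?mul1r//.
  by rewrite expf_neq0.
rewrite (_ : layer_gap _ _ _ _ = sqnorm v - l ^+ 2 * wsqnorm a v); last first.
  rewrite /sqnorm /wsqnorm mulr_sumr -sumrB; apply: eq_bigr => i _.
  by rewrite tnth_mktuple addr0; field.
rewrite subr_gt0 /layer_sqD.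
set P := \prod_(i < n) _; set S := \sum_(i < n) 2 * _ * _.
transitivity (P * S * (iverson (0 < l) * (iverson (l ^+ 2 * wsqnorm a v < sqnorm v) *
  expR (- sqnorm v)))); first by ring.
rewrite {}/P {}/S mulr_sumr mulr_suml; apply: eq_bigr => j _.
rewrite (prod_layer_den r l j) tnth_mktuple addr0.
set S := \sum_(m < n) _; transitivity (2 * a j ^+ 2 * S *
   (iverson (0 < l) * (iverson (l ^+ 2 * wsqnorm a v < sqnorm v) *
    (tnth v j ^+ 2 * expR (- sqnorm v))))); first by field.
rewrite /S mulr_sumr mulr_suml; apply: eq_bigr => m _.
rewrite /layer_weight /layer_integrand; ring.
Qed.

Lemma integral_layer_density_tuple (r l : R) : 0 < r ->
  (\int[L n]_x (layer_density a r l x)%:E =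
   \sum_(j < n) \sum_(m < n) (layer_weight r j m)%:E *
      \int[L n]_v (layer_integrand a j m l v)%:E)%E.
Proof.
move=> r0; have [l0|l0] := ltP 0 l; last first.
  rewrite integral0_eq; last by move=> x _; rewrite /layer_density ltNge l0 mul0r.
  rewrite big1// => j _; rewrite big1// => m _.
  rewrite integral0_eq ?mule0// => x _.
  by rewrite /layer_integrand ltNge l0 !mul0r.
have d0 i : 0 < r + l * a i ^+ 2 by rewrite ltr_pwDl// mulr_ge0 ?sqr_ge0// ltW.
have mJ : measurable_fun setT (layer_density a r l : n.-tuple mR -> R).
  by rewrite /layer_density /layer_gap /layer_sq /layer_sqD; mfun.
have mI j m : measurable_fun setT (fun v => layer_integrand a j m l v : R).
  by rewrite /layer_integrand /wsqnorm /sqnorm; mfun.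
rewrite -(@integral_tuple_affine _ _ (fun i => r + l * a i ^+ 2) (fun _ => 0)
  (fun x => (layer_density a r l x)%:E)); last 3 first.
- by move=> i; rewrite gt_eqF.
- exact/measurable_EFinP.
- by move=> x; rewrite lee_fin layer_density_ge0.
under eq_bigr do rewrite gtr0_norm//.
rewrite -ge0_integralZl_real; last 3 first.
- by apply: prodr_ge0 => i _; exact: ltW.
- exact: (measurableT_comp mJ (@measurable_tuple_affine _ _ _ _)).
- by move=> x; exact: layer_density_ge0.
under eq_integral do rewrite layer_density_affine// -sumEFin.
rewrite ge0_integral_sum//; last 2 first.
- by move=> j; mfun; exact: mI.
- move=> j v _; rewrite lee_fin; apply: sumr_ge0 => m _.
  by rewrite mulr_ge0 ?layer_weight_ge0 ?layer_integrand_ge0// ltW.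
apply: eq_bigr => j _.
under eq_integral do rewrite -sumEFin.
rewrite ge0_integral_sum//; last 2 first.
- by move=> m; mfun; exact: mI.
- by move=> m v _; rewrite lee_fin mulr_ge0 ?layer_weight_ge0 ?layer_integrand_ge0// ltW.
apply: eq_bigr => m _.
rewrite ge0_integralZl_real//; first by rewrite layer_weight_ge0// ltW.
by move=> v; exact: layer_integrand_ge0.
Qed.

Lemma integral_gauge_gauss (r : R) : 0 < r ->
  (\int[L n]_x gauge_gauss a r x = (r ^+ n * Num.sqrt pi ^+ n)%:E +
   \sum_(j < n) \sum_(m < n) (layer_weight r j m)%:E * layer_integral a j m)%E.
Proof.
move=> r0.
have mJ := @measurable_layer_density R n a r.
have mH j m : measurable_fun setT (fun l => \int[L n]_v (layer_integrand a j m l v)%:E)%E.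
  apply: (@measurable_fun_fubini_tonelli_F _ _ _ _ _ (L n)
    (fun z => (layer_integrand a j m z.1 z.2)%:E)).
    by apply/measurable_EFinP; exact: measurable_layer_integrand.
  by move=> z; rewrite lee_fin layer_integrand_ge0.
have H0 j m l : (0 <= \int[L n]_v (layer_integrand a j m l v)%:E)%E.
  by apply: integral_ge0 => v _; rewrite lee_fin layer_integrand_ge0.
rewrite ge0_integralD//; last 3 first.
- by rewrite /layer_sq; mfun.
- by move=> x _; apply: integral_ge0 => l _; rewrite lee_fin layer_density_ge0.
- apply: (@measurable_fun_fubini_tonelli_G _ _ _ _ _ mu (fun z => (layer_density a r z.1 z.2)%:E)).
    by apply/measurable_EFinP.
  by move=> z; rewrite lee_fin layer_density_ge0.
congr (_ + _)%E.
  transitivity (\int[L n]_v (expR (- sqnorm (tuple_affine (fun=> r^-1) (fun=> 0%R) v)))%:E)%E.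
    apply: eq_integral => v _; rewrite sqnorm_scale; congr (expR (- _))%:E.
    rewrite /layer_sq /sqnorm mulr_sumr; apply: eq_bigr => i _.
    by rewrite mul0r addr0 exprVn mulrC.
  have mN := @measurable_sqnorm R n.
  rewrite (@integral_tuple_scale _ _ r^-1 (fun v => (expR (- sqnorm v))%:E)) ?invr_gt0//; last by mfun.
  by rewrite integral_gauss_tuple exprVn invrK -EFinM.
transitivity (\int[mu]_l \int[L n]_x (layer_density a r l x)%:E)%E.
  apply: esym; apply: ge0_tonelli => // l x; exact: layer_density_ge0.
under eq_integral do rewrite integral_layer_density_tuple//.
have W0 j m : (0 <= (layer_weight r j m)%:E)%E by rewrite lee_fin layer_weight_ge0// ltW.
rewrite ge0_integral_sum//; last 2 first.
- by move=> j; apply: emeasurable_sum => m; exact: measurable_funeM.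
- by move=> j l _; apply: sume_ge0 => m _; exact: mule_ge0.
apply: eq_bigr => j _; rewrite ge0_integral_sum//; last 2 first.
- by move=> m; exact: measurable_funeM.
- by move=> m l _; exact: mule_ge0.
by apply: eq_bigr => m _; rewrite ge0_integralZl.
Qed.

(** The intrinsic volumes of the ellipsoid; [m.+1] keeps the exponent [k - 1] of the
    formula free of truncated subtraction. *)
Definition ellipsoid_intrinsic (k : nat) : R :=
  if k is m.+1 then
    kappa m.+1 * \sum_(j < n) (a j ^+ 2 * minor_sym j m * fine (ellipsoid_integral a j m))
  else 1.

Lemma kappaE k : kappa k = Num.sqrt pi ^+ k / (2 * gauss_momentR k.+1) :> R.
Proof.
rewrite /kappa GammaE; congr (_ / _).
by rewrite mulrC powRrM powR12_sqrt ?pi_ge0// powR_mulrn ?sqrtr_ge0.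
Qed.

Lemma kappa_gt0 k : 0 < kappa k :> R.
Proof. by rewrite kappaE divr_gt0 ?exprn_gt0 ?sqrtr_gt0 ?pi_gt0// mulr_gt0 ?gauss_momentR_gt0. Qed.

Definition ellipsoid_steiner_sum (r : R) : R :=
  \sum_(k < n.+1) kappa (n - k) * ellipsoid_intrinsic k * r ^+ (n - k).

Lemma volume_parallel_body (r : R) : 0 < r ->
  L n [set t : n.-tuple mR | parallel_body a r (row_of_tuple t)] = (ellipsoid_steiner_sum r)%:E.
Proof.
move=> r0.
have := volume_gauge a0 r0; rewrite integral_gauge_gauss//.
under eq_bigr => j _ do under eq_bigr => m _ do
  rewrite layer_integralE// (@radial_integral_closed _ _ _ _ _ (n - m) a0 (subnKC (ltnW (ltn_ord m))))
    -!EFinM.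
under eq_bigr do rewrite sumEFin.
rewrite sumEFin -EFinD => E.
have g0 := @gauss_momentR_gt0 R n.+1.
have c0 : 0 < 2 * gauss_momentR n.+1 :> R by rewrite mulr_gt0.
rewrite -[LHS]mul1e -[X in (X * _)%E](_ : (2 * gauss_momentR n.+1)^-1%:E *
  (2 * gauss_momentR n.+1)%:E = 1)%E; last by rewrite -EFinM mulVf// gt_eqF.
rewrite -muleA E -EFinM; congr EFin; rewrite mulrDr /ellipsoid_steiner_sum big_ord_recl subn0 mulr1.
congr (_ + _); first by rewrite kappaE; field; rewrite gt_eqF.
rewrite exchange_big/= mulr_sumr; apply: eq_bigr => m _.
rewrite /bump/= add1n [in RHS](mulrA (kappa _)) [RHS]mulrAC !mulr_sumr; apply: eq_bigr => j _.
have gm := @gauss_momentR_gt0 R m; have gnm := @gauss_momentR_gt0 R (n - m).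
rewrite !kappaE -gauss_momentR_rec subnSK ?ltn_ord// /layer_weight -subn1 -subnDA add1n.
have -> : Num.sqrt pi ^+ n = Num.sqrt pi ^+ m.+1 * Num.sqrt pi ^+ (n - m.+1) :> R.
  by rewrite -exprD subnKC// ltn_ord.
set x := Num.sqrt pi ^+ m.+1; set y := Num.sqrt pi ^+ _; set z := r ^+ _; set I := fine _.
by field; rewrite nat1r !gt_eqF/=.
Qed.

End steiner_sum.


(** * Steiner's formula *)

Section steiner_formula.
Context {R : realType}.
Local Notation mR := (measurableTypeR R).
Local Notation mu := (@lebesgue_measure R).
Local Notation L := (@lebesgue_tuple R).

(** A substitute for letting [r] tend to [0] in polynomial inequalities. *)
Lemma horner_ge0_at0 (p : {poly R}) : (forall r, 0 < r -> 0 <= p.[r]) -> 0 <= p.[0].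
Proof.
move=> p0.
have p_cvg : p.[x] @[x --> 0^'+] --> p.[0].
  by apply: cvg_at_right_filter; exact: continuous_horner.
rewrite -(cvg_lim _ p_cvg)//; apply: limr_ge; first by apply/cvg_ex; exists p.[0].
near=> x; apply: p0; near: x; exact: nbhs_right_gt.
Unshelve. all: by end_near. Qed.

Lemma horner_eq0_ge0 (p : {poly R}) : (forall r, 0 <= r -> p.[r] = 0) -> p = 0.
Proof.
move=> p0; apply/eqP/negPn/negP => pn0.
have := @max_poly_roots _ p [seq i%:R | i <- iota 0 (size p)] pn0.
rewrite size_map size_iota ltnn => h; apply/notF/h.
  by apply/allP => _ /mapP[i _ ->]; apply/rootP; exact: p0.
by rewrite map_inj_uniq ?iota_uniq// => i j /eqP; rewrite eqr_nat => /eqP.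
Qed.

Definition steiner_polynomial n (V : nat -> R) : {poly R} :=
  \sum_(k < n.+1) (kappa (n - k) * V k) *: 'X^(n - k).

Lemma horner_steiner_polynomial n (V : nat -> R) (r : R) :
  (steiner_polynomial n V).[r] = \sum_(k < n.+1) kappa (n - k) * V k * r ^+ (n - k).
Proof.
rewrite horner_sum; apply: eq_bigr => k _.
by rewrite hornerZ hornerXn.
Qed.

Lemma coef_steiner_polynomial n (V : nat -> R) (k : 'I_n.+1) :
  (steiner_polynomial n V)`_(n - k) = kappa (n - k) * V k.
Proof.
rewrite coef_sum (bigD1 k)//= big1 ?addr0; first by rewrite coefZ coefXn eqxx mulr1.
move=> j jk; rewrite coefZ coefXn; case: eqP => [njk|]; last by rewrite mulr0.
move/eqP: jk; case; apply: val_inj => /=.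
by rewrite -(subKn (leq_ord j)) -njk subKn// leq_ord.
Qed.

Lemma steiner_formula_unique n (K : set 'rV[R]_n) (V W : 'I_n.+1 -> R) :
  steiner_formula K V -> steiner_formula K W -> V =1 W.
Proof.
move=> sV sW k.
pose ext (U : 'I_n.+1 -> R) (i : nat) := U (inord i).
have extE U (i : 'I_n.+1) : ext U i = U i by rewrite /ext inord_val.
have E : steiner_polynomial n (ext V) = steiner_polynomial n (ext W).
  apply/eqP; rewrite -subr_eq0; apply/eqP/horner_eq0_ge0 => r r0.
  rewrite hornerD hornerN !horner_steiner_polynomial; apply/eqP; rewrite subr_eq0; apply/eqP.
  have := sV r r0; rewrite (sW r r0) => -[].
  under eq_bigr do rewrite -(extE W); under [in X in _ = X -> _]eq_bigr do rewrite -(extE V).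
  by [].
have := congr1 (fun p : {poly R} => p`_(n - k)) E.
rewrite /= !coef_steiner_polynomial !extE; apply: mulfI.
by rewrite gt_eqF// kappa_gt0.
Qed.

Section fixed_axes.
Variables (n : nat) (a : 'I_n -> R) (a0 : forall i, 0 < a i).

Lemma parallel_body0 : parallel_body a 0 = std_ellipsoid a.
Proof.
apply/seteqP; split => [_ [y yE [_ [z zB <-] <-]]|x xE]; first by rewrite scale0r addr0.
exists x => //; exists 0; last by rewrite addr0.
exists 0; last by rewrite scaler0.
rewrite /unit_ball/= /enorm big1 ?sqrtr0// => i _; rewrite mxE expr0n//.
Qed.

Lemma measurable_std_ellipsoid :
  measurable [set t : n.-tuple mR | std_ellipsoid a (row_of_tuple t)].
Proof.
pose g (t : n.-tuple mR) : \bar R := (\sum_(i < n) tnth t i ^+ 2 / a i ^+ 2)%:E.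
rewrite (_ : [set t | _] = setT `&` [set t | (g t <= 1%:E)%E]).
  by apply: emeasurable_fun_infty_c => //; rewrite /g; mfun.
rewrite setTI; apply/seteqP; split => t; rewrite /std_ellipsoid/= /g lee_fin;
  by under eq_bigr do rewrite mxE.
Qed.

Lemma std_ellipsoid_sub_parallel_body r : std_ellipsoid a `<=` parallel_body a r.
Proof.
move=> x xE; exists x => //; exists 0; last by rewrite addr0.
exists 0; last by rewrite scaler0.
rewrite /unit_ball/= /enorm big1 ?sqrtr0// => i _; rewrite mxE expr0n//.
Qed.

(** The unit ball lies in the dilate of [E] by the sum [M] of the [1 / a_i], so that
    [E + r B] lies in [E + r M E], and [E] is convex. *)
Lemma parallel_body_sub_dilate (r : R) (x : 'rV[R]_n) : 0 <= r ->
  parallel_body a r x ->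
  std_ellipsoid a ((1 + r * \sum_(i < n) (a i)^-1)^-1 *: x).
Proof.
move=> r0 [y yE [_ [z zB <-] <-]].
set M := \sum_(i < n) (a i)^-1.
have M0 : 0 <= M by apply: sumr_ge0 => i _; rewrite invr_ge0 ltW.
have aM i : (a i)^-1 <= M by exact: inv_le_sum_inv.
have z1 : \sum_(i < n) z 0 i ^+ 2 <= 1.
  move: zB; rewrite /unit_ball/= /enorm -{1}sqrtr1 ler_psqrt// nnegrE// sumr_ge0// => i _.
  exact: sqr_ge0.
have s0 : 0 <= r * M by exact: mulr_ge0.
set s := r * M in s0 *.
have s1 : 0 < 1 + s by rewrite ltr_pwDl.
have y1 : \sum_(i < n) y 0 i ^+ 2 / a i ^+ 2 <= 1 by [].
rewrite /std_ellipsoid/=.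
apply: (@le_trans _ _ ((\sum_(i < n) y 0 i ^+ 2 / a i ^+ 2 + s * \sum_(i < n) z 0 i ^+ 2) / (1 + s))).
  rewrite mulr_sumr -big_split/= mulr_suml; apply: ler_sum => i _.
  rewrite !mxE ler_pdivlMr//.
  set u := y 0 i / a i; set v := z 0 i.
  have [M00|Mn0] := eqVneq M 0.
    have := aM i; rewrite M00 leNgt invr_gt0 a0//.
  have Mp : 0 < M by rewrite lt_neqAle eq_sym Mn0.
  (* [M w] is the coordinate [z_i / a_i], to which convexity of the square applies
     with weights [1 / (1 + s)] and [s / (1 + s)] *)
  pose w := v / (a i * M).
  have w2 : w ^+ 2 <= v ^+ 2.
    rewrite /w expr_div_n ler_pdivrMr ?exprn_gt0 ?mulr_gt0//.
    apply: ler_peMr; first exact: sqr_ge0.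
    by rewrite exprn_ege1// -(mulfV (lt0r_neq0 (a0 i))) ler_pM2l.
  have -> : ((1 + s)^-1 * (y 0 i + r * v)) ^+ 2 / a i ^+ 2 * (1 + s) = (u + s * w) ^+ 2 / (1 + s).
    by rewrite /u /w /s; field; rewrite !gt_eqF.
  have -> : y 0 i ^+ 2 / a i ^+ 2 = u ^+ 2 by rewrite /u expr_div_n.
  apply: (@le_trans _ _ (u ^+ 2 + s * w ^+ 2)); last by rewrite lerD2l ler_wpM2l.
  rewrite ler_pdivrMr// -subr_ge0.
  have -> : (u ^+ 2 + s * w ^+ 2) * (1 + s) - (u + s * w) ^+ 2 = s * (u - w) ^+ 2 by ring.
  by rewrite mulr_ge0 ?sqr_ge0.
rewrite ler_pdivrMr// mul1r; apply: lerD => //.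
by rewrite -[leRHS]mulr1 ler_wpM2l.
Qed.

Lemma ellipsoid_steiner_sumE r : ellipsoid_steiner_sum a r = (steiner_polynomial n (ellipsoid_intrinsic a)).[r].
Proof. by rewrite horner_steiner_polynomial. Qed.

(** The parametrization by [l] degenerates at [r = 0]. Instead, [E] lies in
    [E + r B], which lies in [(1 + r M) E], and both inclusions become equalities of
    volumes in the limit. *)
Lemma volume_std_ellipsoid :
  L n [set t : n.-tuple mR | std_ellipsoid a (row_of_tuple t)] = (ellipsoid_steiner_sum a 0)%:E.
Proof.
set A := [set t | _].
have mA : measurable A := measurable_std_ellipsoid.
have le1 r : 0 < r -> (L n A <= (ellipsoid_steiner_sum a r)%:E)%E.
  move=> r0; rewrite -volume_parallel_body//; apply: le_measure.
  - by rewrite inE.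
  - by rewrite inE; exact: measurable_parallel_body.
  - by move=> t; exact: std_ellipsoid_sub_parallel_body.
have le2 r : 0 < r -> ((ellipsoid_steiner_sum a r)%:E <=
    ((1 + r * \sum_(i < n) (a i)^-1) ^+ n)%:E * L n A)%E.
  move=> r0.
  have s1 : 0 < 1 + r * \sum_(i < n) (a i)^-1.
    by rewrite ltr_pwDl// mulr_ge0 ?(ltW r0)// sumr_ge0// => i _; rewrite invr_ge0 ltW.
  rewrite -volume_parallel_body// -lebesgue_tuple_dilate//; apply: le_measure.
  - by rewrite inE; exact: measurable_parallel_body.
  - by rewrite inE -[X in measurable X]setTI; exact: measurable_tuple_affine.
  - move=> t /(parallel_body_sub_dilate (ltW r0)).
    rewrite /A/=; set c := (_)^-1; rewrite (_ : row_of_tuple (tuple_affine _ _ _) = c *: row_of_tuple t)//.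
    by apply/rowP => i; rewrite !mxE tnth_mktuple addr0.
have : L n A \is a fin_num.
  by rewrite ge0_fin_numE// (le_lt_trans (le1 1 ltr01))// ltry.
move: le1 le2; case: (L n A) => [e| |]// le1 le2 _; congr EFin; apply/eqP; rewrite eq_le.
apply/andP; split.
- have := @horner_ge0_at0 (steiner_polynomial n (ellipsoid_intrinsic a) - e%:P).
  rewrite hornerD hornerN hornerC -ellipsoid_steiner_sumE subr_ge0; apply => r r0.
  by rewrite hornerD hornerN hornerC -ellipsoid_steiner_sumE subr_ge0 -lee_fin le1.
- have h : 0 <= ((1 + (\sum_(i < n) (a i)^-1) *: 'X) ^+ n * e%:P -
      steiner_polynomial n (ellipsoid_intrinsic a)).[0].
    apply: horner_ge0_at0 => r r0; rewrite !hornerE -ellipsoid_steiner_sumE subr_ge0 -lee_fin.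
    by rewrite [_ * r]mulrC EFinM; exact: le2.
  move: h; rewrite hornerD hornerN hornerM horner_exp hornerD hornerZ hornerX !hornerC.
  by rewrite -ellipsoid_steiner_sumE mulr0 addr0 expr1n mul1r subr_ge0.
Qed.

Lemma minkowski_sum_rigid (f : 'rV[R]_n -> 'rV[R]_n) (K : set 'rV[R]_n) r :
  rigid_motion f ->
  minkowski_sum (f @` K) (dilate r (@unit_ball R n)) =
  f @` (minkowski_sum K (dilate r (@unit_ball R n))).
Proof.
move=> [Q [c [QQ fE]]].
have QtQ : Q^T *m Q = 1%:M by exact: mulmx1C.
have ball_mul (P : 'M[R]_n) z : P *m P^T = 1%:M -> unit_ball z -> unit_ball (z *m P).
  move=> PP; have enormE (x : 'rV[R]_n) : enorm x = Num.sqrt ((x *m x^T) 0 0).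
    by congr Num.sqrt; rewrite mxE; apply: eq_bigr => i _; rewrite mxE expr2.
  by rewrite /unit_ball/= !enormE trmx_mul mulmxA -(mulmxA z) PP mulmx1.
apply/seteqP; split => [_ [_ [y yK <-] [_ [z zB <-] <-]]|_ [_ [y yK [_ [z zB <-] <-]] <-]].
- exists (y + r *: (z *m Q^T)).
    exists y => //; exists (r *: (z *m Q^T)) => //; exists (z *m Q^T) => //.
    by apply: ball_mul; rewrite ?trmxK.
  by rewrite !fE mulmxDl -scalemxAl -mulmxA QtQ mulmx1 addrAC.
- exists (f y); first by exists y.
  exists (r *: (z *m Q)); last by rewrite !fE mulmxDl -scalemxAl addrAC.
  by exists (z *m Q) => //; exact: ball_mul.
Qed.

Lemma steiner_formula_ellipsoid (E : set 'rV[R]_n) : is_ellipsoid a E ->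
  steiner_formula E (fun k => ellipsoid_intrinsic a k).
Proof.
move=> [f rf ->] r; rewrite le_eqVlt => r0.
rewrite -/(std_ellipsoid a) minkowski_sum_rigid// -/(parallel_body a r).
have -> : \sum_(k < n.+1) kappa (n - k) * ellipsoid_intrinsic a k * r ^+ (n - k) =
  ellipsoid_steiner_sum a r by [].
move: r0 => /predU1P[<-|r0].
- rewrite parallel_body0 volume_rigid//; first exact: volume_std_ellipsoid.
  exact: measurable_std_ellipsoid.
- rewrite volume_rigid//; first exact: volume_parallel_body.
  exact: measurable_parallel_body.
Qed.

Lemma fine_ellipsoid_integral (j : 'I_n) m :
  fine (ellipsoid_integral a j m) =
  \int[lebesgue_measure]_(t in `[0, +oo[)
       (t ^+ m / ((a j ^+ 2 * t ^+ 2 + 1) *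
         \prod_(i < n) Num.sqrt (a i ^+ 2 * t ^+ 2 + 1))).
Proof.
rewrite /Rintegral; congr fine.
rewrite -integral_itv_obnd_cbnd; last by apply: measurable_funTS; mfun.
rewrite (_ : `]0, +oo[%classic = [set x | 0 < x]); last first.
  by apply/seteqP; split => x /=; rewrite in_itv/= andbT.
by rewrite (integral_iverson (fun x => 0 < x)).
Qed.

End fixed_axes.
End steiner_formula.

Unset Implicit Arguments.
Set Strict Implicit.

Theorem theorem1 (R : realType) (d : nat) (hd : (2 <= d)%N)
  (a : 'I_d -> R) (ha : forall i, 0 < a i)
  (E : set 'rV[R]_d) (hE : is_ellipsoid a E)
  (k : 'I_d.+1) (hk : (1 <= k)%N) :
  intrinsic_volume E k =
  kappa k * \sum_(i < d)
    (a i ^+ 2 * elem_sym k.-1 (fun j : 'I_d.-1 => a (lift i j) ^+ 2) *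
     \int[lebesgue_measure]_(t in `[0, +oo[)
       (t ^+ k.-1 /
        ((a i ^+ 2 * t ^+ 2 + 1) *
         \prod_(j < d) Num.sqrt (a j ^+ 2 * t ^+ 2 + 1)))).
Proof.
have sE := steiner_formula_ellipsoid ha hE.
transitivity (ellipsoid_intrinsic a k).
  apply: xget_unique; first by exists (fun k : 'I_d.+1 => ellipsoid_intrinsic a k).
  by move=> _ [V sV ->]; exact: steiner_formula_unique sV sE k.
case: k hk => -[|m]//= _ _; congr (_ * _).
by apply: eq_bigr => j _; rewrite -fine_ellipsoid_integral.
Qed.
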